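(* Let $\omega_1,\omega_2\in\mathbb C$ be nonzero with $\omega_1/\omega_2\notin\mathbb R$, let $\Lambda=\{a\omega_1+b\omega_2: a,b\in\mathbb Z\}$, and let $f$ be an elliptic function on $\Lambda$ that is not identically zero. Let $a_1,\dots,a_n$ be the distinct zeros and poles of $f$ in the fundamental parallelogram $P=\{s\omega_1+t\omega_2: 0\le s<1,\ 0\le t<1\}$, and let $m_1,\dots,m_n$ be the corresponding multiplicities, where a zero of order $m$ has multiplicity $m$ and a pole of order $m$ has multiplicity $-m$. Then $$\sum_{k=1}^n a_k m_k\in\Lambda.$$
   Context: A meromorphic function $f$ on $\mathbb C$ is called elliptic on $\Lambda$ if $f(z+\omega_1)=f(z+\omega_2)=f(z)$ for all $z\in\mathbb C$. The set $P$ contains exactly one representative of each class of $\mathbb C$ modulo $\Lambda$. *)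

(* Defs.v *)
(* Stdlib reals with Coquelicot's complex numbers. *)
From Stdlib Require Import Reals ZArith.
From Coquelicot Require Import Coquelicot.
Open Scope C_scope.

(* A meromorphic function is a map from C to the Riemann sphere: [Some w] is
   the finite value [w], [None] is the point at infinity. *)
Definition sphere : Type := option C.

Definition holomorphic_at (g : C -> C) (a : C) : Prop :=
  locally a (fun z => ex_derive (K := C_AbsRing) (V := C_NormedModule) g z).

Definition regular_at (f : C -> sphere) (a : C) : Prop :=
  exists g : C -> C,
    holomorphic_at g a /\ locally a (fun z => f z = Some (g z)).

Definition zero_of_order (f : C -> sphere) (a : C) (m : nat) : Prop :=
  (0 < m)%nat /\
  exists g : C -> C,
    holomorphic_at g a /\ g a <> 0 /\
    locally a (fun z => f z = Some ((z - a) ^ m * g z)).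

(* [locally'] is the filter of punctured neighbourhoods. *)
Definition pole_of_order (f : C -> sphere) (a : C) (m : nat) : Prop :=
  (0 < m)%nat /\ f a = None /\
  exists g : C -> C,
    holomorphic_at g a /\ g a <> 0 /\
    locally' a (fun z => f z = Some (g z / (z - a) ^ m)).

Definition is_zero (f : C -> sphere) (a : C) : Prop := f a = Some (RtoC 0).

Definition is_pole (f : C -> sphere) (a : C) : Prop :=
  exists m : nat, pole_of_order f a m.

Definition meromorphic (f : C -> sphere) : Prop :=
  forall a : C, regular_at f a \/ is_pole f a.

Definition elliptic (w1 w2 : C) (f : C -> sphere) : Prop :=
  meromorphic f /\ forall z : C, f (z + w1) = f z /\ f (z + w2) = f z.

Definition has_multiplicity (f : C -> sphere) (a : C) (k : Z) : Prop :=
  exists m : nat,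
    (zero_of_order f a m /\ k = Z.of_nat m) \/
    (pole_of_order f a m /\ k = (- Z.of_nat m)%Z).

Definition lattice (w1 w2 z : C) : Prop :=
  exists a b : Z, z = RtoC (IZR a) * w1 + RtoC (IZR b) * w2.

Definition parallelogram (w1 w2 z : C) : Prop :=
  exists s t : R,
    (0 <= s < 1)%R /\ (0 <= t < 1)%R /\ z = RtoC s * w1 + RtoC t * w2.

(* Main.v *)
(* Translate the fundamental parallelogram slightly so that all the zeros and
   poles a_k lie in its interior. There f = h * prod (z - a_k)^(m_k) with h
   holomorphic and nonvanishing, so h has a holomorphic logarithm, whose contour
   integral vanishes by Goursat's theorem. Adding m_k log(z - a_k) on each side
   gives logarithms of f on the four sides, and the contour integral of
   z dlog f, integrated by parts, is a combination of side integrals of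
   log f. For z - a_k it is 2 pi i (p - a_k) modulo 2 pi i Lambda, where p is
   the translation, since z log z - z is a primitive of log z. For f, the
   logarithms on opposite sides differ by a constant in 2 pi i Z because f is
   periodic; hence the integral of dlog f gives sum m_k = 0, and that of z dlog f
   gives sum m_k (p - a_k) in Lambda. The derivative of f is never used. *)
Require Import Defs.
From Stdlib Require Import Reals ZArith Lra Lia Psatz Ranalysis5 Classical ClassicalEpsilon.
From Coquelicot Require Import Coquelicot.
Open Scope C_scope.

(** * Complex continuity and differentiability *)

(** Integration by parts removes the derivative: around the boundary, the integral of z dlog f is a
    sum of corner terms minus the integral of log f dz. With one logarithm per side, the two
    logarithms that meet at a corner differ there by an element of 2 pi i Z, so the corner terms add
    up to 2 pi i (p k + an element of Lambda), where k is the sum of the four corner integers.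
    Replacing the logarithm on one side by another continuous one changes the side integrals by an
    element of 2 pi i Lambda. Everything is thus determined modulo 2 pi i Lambda, which is the
    precision the theorem asks for, and no branch has to be followed around the contour. *)

Definition ccont {U : UniformSpace} (f : U -> C) (x : U) : Prop :=
  continuous (T:=U) (U := C_UniformSpace) f x.

Lemma Ceq_components (u v : C) : fst u = fst v -> snd u = snd v -> u = v.
Proof. destruct u, v; simpl; congruence. Qed.

Lemma ccont_components {U : UniformSpace} (f : U -> C) (x : U) :
  continuous (fun y => fst (f y)) x -> continuous (fun y => snd (f y)) x ->
  ccont f x.
Proof.
intros h1 h2.
apply (continuous_ext (U := C_UniformSpace) (fun y => (fst (f y), snd (f y)))).
{ intro y; now destruct (f y). }
apply (continuous_comp_2 (X := C_UniformSpace) _ _ (fun a b : R => (a, b)) x h1 h2).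
apply (continuous_ext (U := C_UniformSpace) (fun p : R * R => p)).
{ now intros [? ?]. }
apply continuous_id.
Qed.

Lemma ccont_fst {U : UniformSpace} (f : U -> C) (x : U) :
  ccont f x -> continuous (fun y => fst (f y)) x.
Proof.
intro h. apply (continuous_comp (V := C_UniformSpace) f (fun p : C => fst p) x h).
destruct (f x) as [u v]. apply (continuous_fst (U := R_UniformSpace) (V := R_UniformSpace)).
Qed.

Lemma ccont_snd {U : UniformSpace} (f : U -> C) (x : U) :
  ccont f x -> continuous (fun y => snd (f y)) x.
Proof.
intro h. apply (continuous_comp (V := C_UniformSpace) f (fun p : C => snd p) x h).
destruct (f x) as [u v]. apply (continuous_snd (U := R_UniformSpace) (V := R_UniformSpace)).
Qed.

Lemma ccont_const {U : UniformSpace} (c : C) (x : U) : ccont (fun _ => c) x.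
Proof. apply continuous_const. Qed.

Lemma ccont_id (z : C) : ccont (U := C_UniformSpace) (fun y => y) z.
Proof. apply continuous_id. Qed.

Lemma ccont_RtoC {U : UniformSpace} (f : U -> R) (x : U) :
  continuous f x -> ccont (fun y => RtoC (f y)) x.
Proof. intro h. apply ccont_components; simpl; [exact h | apply continuous_const]. Qed.

Lemma ccont_plus {U : UniformSpace} (f g : U -> C) (x : U) :
  ccont f x -> ccont g x -> ccont (fun y => f y + g y) x.
Proof.
intros h1 h2; apply ccont_components; simpl.
- apply (continuous_plus (V := R_NormedModule)); now apply ccont_fst.
- apply (continuous_plus (V := R_NormedModule)); now apply ccont_snd.
Qed.

Lemma ccont_mult {U : UniformSpace} (f g : U -> C) (x : U) :
  ccont f x -> ccont g x -> ccont (fun y => f y * g y) x.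
Proof.
intros h1 h2; apply ccont_components; simpl.
- apply (continuous_minus (V := R_NormedModule));
    apply (continuous_mult (K := R_AbsRing)); now (apply ccont_fst || apply ccont_snd).
- apply (continuous_plus (V := R_NormedModule));
    apply (continuous_mult (K := R_AbsRing)); now (apply ccont_fst || apply ccont_snd).
Qed.

Lemma ccont_opp {U : UniformSpace} (f : U -> C) (x : U) :
  ccont f x -> ccont (fun y => - f y) x.
Proof.
intros h; apply ccont_components; simpl.
- apply (continuous_opp (V := R_NormedModule)); now apply ccont_fst.
- apply (continuous_opp (V := R_NormedModule)); now apply ccont_snd.
Qed.

Lemma ccont_minus {U : UniformSpace} (f g : U -> C) (x : U) :
  ccont f x -> ccont g x -> ccont (fun y => f y - g y) x.
Proof. intros; apply ccont_plus; auto. now apply ccont_opp. Qed.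

Lemma norm2_neq0 (z : C) : z <> 0 -> (fst z ^ 2 + snd z ^ 2 <> 0)%R.
Proof.
destruct z as [x y]; simpl; intros h e. apply h, Ceq_components; simpl; nra.
Qed.

Lemma ccont_inv {U : UniformSpace} (f : U -> C) (x : U) :
  ccont f x -> f x <> 0 -> ccont (fun y => / f y) x.
Proof.
intros h n. apply norm2_neq0 in n.
assert (hf := ccont_fst _ _ h). assert (hs := ccont_snd _ _ h).
assert (hd : continuous (fun y => / (fst (f y) ^ 2 + snd (f y) ^ 2))%R x).
{ apply (continuous_comp (fun y => (fst (f y) ^ 2 + snd (f y) ^ 2)%R) Rinv).
  - simpl. apply (continuous_plus (V := R_NormedModule));
    repeat (apply (continuous_mult (K := R_AbsRing)); [assumption|]);
    apply continuous_const.
  - now apply continuous_Rinv. }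
apply ccont_components; simpl fst; simpl snd; unfold Rdiv;
  apply (continuous_mult (K := R_AbsRing)); auto.
apply (continuous_opp (V := R_NormedModule)); auto.
Qed.

Lemma ccont_comp {U : UniformSpace} (g : C -> C) (f : U -> C) (x : U) :
  ccont f x -> ccont (U := C_UniformSpace) g (f x) -> ccont (fun y => g (f y)) x.
Proof. intros; now apply (continuous_comp (V := C_UniformSpace) f g). Qed.

Lemma ccont_ball {U : UniformSpace} (f : U -> C) (x : U) (eps : R) :
  (0 < eps)%R -> ccont f x -> locally x (fun y => (Cmod (f y - f x) < eps)%R).
Proof.
intros he h.
assert (h' : ccont (fun y => f y - f x) x) by (apply ccont_minus; [auto | apply ccont_const]).
(* Balls of [C_UniformSpace] are squares; [eps / 2] absorbs the factor [sqrt 2] between the max norm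
   and [Cmod]. *)
assert (he' : (0 < eps / 2)%R) by lra.
generalize (filter_and _ _ (proj1 (filterlim_locally _ _) h (mkposreal _ he')) (filter_true)).
apply filter_imp. intros y [[h1 h2] _].
replace (f y - f x) with (minus (f y) (f x)) by reflexivity.
change (Rabs (fst (f y) - fst (f x)) < eps/2)%R in h1.
change (Rabs (snd (f y) - snd (f x)) < eps/2)%R in h2.
apply Rle_lt_trans with (1 := Cmod_2Rmax _).
change (fst (minus (f y) (f x))) with (fst (f y) - fst (f x))%R.
change (snd (minus (f y) (f x))) with (snd (f y) - snd (f x))%R.
set (mm := Rmax _ _).
assert (mm < eps/2)%R by now apply Rmax_lub_lt.
assert (0 <= mm)%R by (eapply Rle_trans; [apply Rabs_pos|apply Rmax_l]).
assert (sqrt 2 <= 2)%R.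
{ rewrite <- (sqrt_pow2 2) at 2 by lra. apply sqrt_le_1; lra. }
nra.
Qed.

Lemma ball_of_Cmod (x y : C) (eps : R) :
  (Cmod (y - x) < eps)%R -> ball (M := C_UniformSpace) x eps y.
Proof. exact (C_NormedModule_mixin_compat1 x y eps). Qed.

Lemma ccont_of_ball {U : UniformSpace} (f : U -> C) (x : U) :
  (forall eps, (0 < eps)%R -> locally x (fun y => (Cmod (f y - f x) < eps)%R)) ->
  ccont f x.
Proof.
intros h. apply filterlim_locally. intros eps.
generalize (h eps (cond_pos eps)). apply filter_imp. intros y hy.
now apply ball_of_Cmod.
Qed.

Lemma ccont_ne0 {U : UniformSpace} (f : U -> C) (x : U) :
  ccont f x -> f x <> 0 -> locally x (fun y => f y <> 0).
Proof.
intros h n. apply Cmod_gt_0 in n.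
generalize (ccont_ball f x _ n h). apply filter_imp. intros y hy e.
rewrite e in hy. replace (0 - f x) with (- f x) in hy by ring.
rewrite Cmod_opp in hy. lra.
Qed.

(* Caratheodory's form of complex differentiability: the difference quotient
   extends continuously, so differentiation rules reduce to continuity rules. *)
Definition cderiv (F : C -> C) (z l : C) : Prop :=
  exists phi : C -> C, ccont (U := C_UniformSpace) phi z /\ phi z = l /\
    locally (T := C_UniformSpace) z (fun y => F y = F z + phi y * (y - z)).

Definition chol (F : C -> C) (z : C) : Prop := exists l, cderiv F z l.

Lemma ex_derive_chol (F : C -> C) (z : C) :
  ex_derive (K := C_AbsRing) (V := C_NormedModule) F z -> chol F z.
Proof.
intros [l [_ h]]. exists l.
specialize (h z (fun P hP => hP)).
exists (fun y => if Ceq_dec y z then l else (F y - F z) / (y - z)).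
split; [|split].
- apply ccont_of_ball. intros eps he.
  assert (he' : (0 < eps / 2)%R) by lra.
  specialize (h (mkposreal _ he')).
  apply locally_C in h.
  generalize h; clear h; apply filter_imp; intros y hy.
  destruct (Ceq_dec z z) as [_|n]; [|now elim n].
  destruct (Ceq_dec y z) as [e|n].
  + replace (l - l) with (RtoC 0) by ring. now rewrite Cmod_0.
  + simpl in hy.
    change (Cmod (F y - F z - (y - z) * l) <= eps/2 * Cmod (y - z))%R in hy.
    assert (n' : y - z <> 0) by now apply Cminus_eq_contra.
    assert (p := proj1 (Cmod_gt_0 _) n').
    replace ((F y - F z) / (y - z) - l) with ((F y - F z - (y - z) * l) / (y - z))
      by (field; auto).
    rewrite Cmod_div by auto.
    apply Rle_lt_trans with (eps / 2)%R; [|lra].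
    apply (Rmult_le_reg_r (Cmod (y - z))); auto.
    unfold Rdiv at 1. rewrite Rmult_assoc, Rinv_l; lra.
- destruct (Ceq_dec z z) as [_|n]; [auto|now elim n].
- apply filter_forall. intros y. destruct (Ceq_dec y z) as [e|n].
  + rewrite e. ring.
  + assert (n' : y - z <> 0) by now apply Cminus_eq_contra. field; auto.
Qed.

Lemma cderiv_cont (F : C -> C) (z l : C) : cderiv F z l -> ccont (U := C_UniformSpace) F z.
Proof.
intros [phi [h1 [h2 h3]]].
apply (continuous_ext_loc (U := C_UniformSpace) _ (fun y => F z + phi y * (y - z))).
{ generalize h3; apply filter_imp; auto. }
apply ccont_plus; [apply ccont_const | apply ccont_mult; auto].
apply ccont_minus; [apply ccont_id | apply ccont_const].
Qed.

Lemma chol_cont (F : C -> C) (z : C) : chol F z -> ccont (U := C_UniformSpace) F z.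
Proof. intros [l h]; eapply cderiv_cont; eauto. Qed.

Lemma cderiv_ext_loc (F G : C -> C) (z l : C) :
  locally (T := C_UniformSpace) z (fun y => F y = G y) -> cderiv F z l -> cderiv G z l.
Proof.
intros e [phi [h1 [h2 h3]]]. exists phi; split; [|split]; auto.
assert (e0 := locally_singleton (T := C_UniformSpace) _ _ e). simpl in e0.
generalize (filter_and _ _ e h3). apply filter_imp. intros y [a b]. congruence.
Qed.

Lemma chol_ext_loc (F G : C -> C) (z : C) :
  locally (T := C_UniformSpace) z (fun y => F y = G y) -> chol F z -> chol G z.
Proof. intros e [l h]. exists l. eapply cderiv_ext_loc; eauto. Qed.

Lemma cderiv_const (c z : C) : cderiv (fun _ => c) z 0.
Proof.
exists (fun _ => RtoC 0); split; [apply ccont_const | split; auto].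
apply filter_forall; intro y; change C in y; ring.
Qed.

Lemma cderiv_id (z : C) : cderiv (fun y => y) z 1.
Proof.
exists (fun _ => RtoC 1); split; [apply ccont_const | split; auto].
apply filter_forall; intro y; change C in y; ring.
Qed.

Lemma cderiv_plus (F G : C -> C) (z l m : C) :
  cderiv F z l -> cderiv G z m -> cderiv (fun y => F y + G y) z (l + m).
Proof.
intros [p [p1 [p2 p3]]] [q [q1 [q2 q3]]].
exists (fun y => p y + q y); split; [now apply ccont_plus | split; [congruence|]].
generalize (filter_and _ _ p3 q3). apply filter_imp. intros y [a b].
rewrite a, b. ring.
Qed.

Lemma cderiv_mult (F G : C -> C) (z l m : C) :
  cderiv F z l -> cderiv G z m -> cderiv (fun y => F y * G y) z (l * G z + F z * m).
Proof.
intros hF hG. assert (cG := cderiv_cont _ _ _ hG).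
destruct hF as [p [p1 [p2 p3]]]. destruct hG as [q [q1 [q2 q3]]].
exists (fun y => p y * G y + F z * q y); split; [|split; [congruence|]].
- apply ccont_plus; apply ccont_mult; auto. apply ccont_const.
- generalize (filter_and _ _ p3 q3). apply filter_imp. intros y [a b].
  rewrite a, b. ring.
Qed.

Lemma cderiv_inv (F : C -> C) (z l : C) :
  cderiv F z l -> F z <> 0 -> cderiv (fun y => / F y) z (- l / (F z * F z)).
Proof.
intros hF n. assert (cF := cderiv_cont _ _ _ hF).
destruct hF as [p [p1 [p2 p3]]].
exists (fun y => - p y * / (F z * F y)); split; [|split].
- apply ccont_mult; [now apply ccont_opp|]. apply ccont_inv; [|now apply Cmult_neq_0].
  apply ccont_mult; auto; apply ccont_const.
- now rewrite p2.
- generalize (filter_and _ _ (ccont_ne0 (U := C_UniformSpace) _ _ cF n) p3).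
  apply filter_imp. intros y [a b].
  assert (e : p y * (y - z) = F y - F z) by (rewrite b; ring).
  replace (- p y * / (F z * F y) * (y - z)) with (- (p y * (y - z)) * / (F z * F y)) by ring.
  rewrite e. field; auto.
Qed.

Lemma cderiv_comp (G F : C -> C) (z l m : C) :
  cderiv F z l -> cderiv G (F z) m -> cderiv (fun y => G (F y)) z (m * l).
Proof.
intros hF hG. assert (cF := cderiv_cont _ _ _ hF).
destruct hF as [p [p1 [p2 p3]]]. destruct hG as [q [q1 [q2 q3]]].
exists (fun y => q (F y) * p y); split; [|split; [congruence|]].
- apply ccont_mult; auto. now apply ccont_comp.
- assert (q4 : locally (T := C_UniformSpace) z
    (fun y => G (F y) = G (F z) + q (F y) * (F y - F z))) by exact (cF _ q3).
  generalize (filter_and _ _ q4 p3). apply filter_imp. intros y [a b].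
  assert (e : p y * (y - z) = F y - F z) by (rewrite b; ring).
  rewrite a, <- Cmult_assoc, e. ring.
Qed.

Lemma chol_const (c z : C) : chol (fun _ => c) z.
Proof. eexists; apply cderiv_const. Qed.

Lemma chol_id (z : C) : chol (fun y => y) z.
Proof. eexists; apply cderiv_id. Qed.

Lemma chol_plus (F G : C -> C) (z : C) :
  chol F z -> chol G z -> chol (fun y => F y + G y) z.
Proof. intros [l h] [m k]; eexists; eapply cderiv_plus; eauto. Qed.

Lemma chol_mult (F G : C -> C) (z : C) :
  chol F z -> chol G z -> chol (fun y => F y * G y) z.
Proof. intros [l h] [m k]; eexists; eapply cderiv_mult; eauto. Qed.

Lemma chol_inv (F : C -> C) (z : C) :
  chol F z -> F z <> 0 -> chol (fun y => / F y) z.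
Proof. intros [l h] n; eexists; eapply cderiv_inv; eauto. Qed.

Lemma chol_comp (G F : C -> C) (z : C) :
  chol F z -> chol G (F z) -> chol (fun y => G (F y)) z.
Proof. intros [l h] [m k]; eexists; eapply (cderiv_comp G F); eauto. Qed.

Lemma chol_minus (F G : C -> C) (z : C) :
  chol F z -> chol G z -> chol (fun y => F y - G y) z.
Proof.
intros hF hG.
apply (chol_ext_loc (fun y => F y + RtoC (-1) * G y)).
{ apply filter_forall; intro y; change C in y; ring. }
apply chol_plus; auto. apply chol_mult; auto. apply chol_const.
Qed.

Lemma chol_pow (F : C -> C) (z : C) (n : nat) :
  chol F z -> chol (fun y => F y ^ n) z.
Proof.
intro h; induction n; simpl; [apply chol_const | now apply chol_mult].
Qed.

(** * Exponential and logarithm *)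

Lemma Cmod_le_sum (v : C) : (Cmod v <= Rabs (fst v) + Rabs (snd v))%R.
Proof.
destruct v as [x y]; simpl.
replace (x, y) with (RtoC x + Ci * RtoC y)
  by (apply Ceq_components; simpl; ring).
apply Rle_trans with (1 := Cmod_triangle _ _).
rewrite Cmod_mult, Cmod_Ci, !Cmod_R; lra.
Qed.

Definition cexp (z : C) : C :=
  ((exp (fst z) * cos (snd z))%R, (exp (fst z) * sin (snd z))%R).

Lemma cexp_plus (u v : C) : cexp (u + v) = cexp u * cexp v.
Proof.
apply Ceq_components; simpl; rewrite exp_plus, ?cos_plus, ?sin_plus; ring.
Qed.

Lemma cexp_0 : cexp 0 = 1.
Proof.
apply Ceq_components; simpl; rewrite exp_0, ?cos_0, ?sin_0; ring.
Qed.

Lemma cexp_mult_opp (u : C) : cexp u * cexp (- u) = 1.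
Proof. rewrite <- cexp_plus, Cplus_opp_r; apply cexp_0. Qed.

Lemma cexp_ne0 (u : C) : cexp u <> 0.
Proof.
intro e. assert (h := cexp_mult_opp u). rewrite e, Cmult_0_l in h.
now apply C1_nz.
Qed.

Lemma cexp_opp (u : C) : cexp (- u) = / cexp u.
Proof.
assert (h := cexp_mult_opp u). assert (n := cexp_ne0 u).
apply (f_equal (fun x => / cexp u * x)) in h.
rewrite Cmult_assoc, Cinv_l, Cmult_1_l, Cmult_1_r in h; auto.
Qed.

Definition two_pi_i : C := (0%R, (2 * PI)%R).

Lemma two_pi_i_ne0 : two_pi_i <> 0.
Proof.
intro e. apply (f_equal snd) in e; simpl in e. generalize PI_RGT_0; lra.
Qed.

Lemma cexp_eq_1 (u : C) : cexp u = 1 -> exists k : Z, u = RtoC (IZR k) * two_pi_i.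
Proof.
intros h. assert (h1 := f_equal fst h). assert (h2 := f_equal snd h). simpl in h1, h2.
assert (p := exp_pos (fst u)).
assert (s : sin (snd u) = 0%R) by nra.
assert (q := sin2_cos2 (snd u)). unfold Rsqr in q. rewrite s in q.
assert (c : cos (snd u) = 1%R) by nra.
assert (x0 : fst u = 0%R).
{ rewrite c in h1. apply exp_inv. rewrite exp_0. lra. }
assert (s2 : sin (snd u / 2) = 0%R).
{ assert (e := cos_2a_sin (snd u / 2)).
  replace (2 * (snd u / 2))%R with (snd u) in e by field. rewrite c in e. nra. }
destruct (sin_eq_0_0 _ s2) as [k hk].
exists k. apply Ceq_components; simpl; [rewrite x0; ring|].
rewrite Rmult_0_l, Rplus_0_r. lra.
Qed.

Lemma cexp_eq (u v : C) :
  cexp u = cexp v -> exists k : Z, u = v + RtoC (IZR k) * two_pi_i.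
Proof.
intros h. destruct (cexp_eq_1 (u + - v)) as [k hk].
- now rewrite cexp_plus, h, cexp_mult_opp.
- exists k. rewrite <- hk. ring.
Qed.

Lemma derivable_pt_lim_remainder (f : R -> R) (d : R) :
  derivable_pt_lim f 0 d -> forall eps : R, (0 < eps)%R ->
  exists delta : R, (0 < delta)%R /\
    forall h, (Rabs h < delta)%R -> (Rabs (f h - f 0 - d * h) <= eps * Rabs h)%R.
Proof.
intros hd eps he. destruct (hd eps he) as [delta hdelta].
exists delta; split; [apply cond_pos|]. intros h hh.
destruct (Req_dec h 0) as [e|n].
- rewrite e. replace (f 0 - f 0 - d * 0)%R with 0%R by ring. rewrite Rabs_R0; lra.
- specialize (hdelta h n hh). rewrite Rplus_0_l in hdelta.
  replace (f h - f 0 - d * h)%R with (((f h - f 0) / h - d) * h)%R by (field; auto).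
  rewrite Rabs_mult. apply Rmult_le_compat_r; [apply Rabs_pos | lra].
Qed.

Lemma cexp_remainder (eps : R) : (0 < eps)%R ->
  exists delta : R, (0 < delta)%R /\
    forall v : C, (Cmod v < delta)%R -> (Cmod (cexp v - 1 - v) <= eps * Cmod v)%R.
Proof.
intros he.
(* With [r = Cmod v], the real part of the remainder will be at most [3 * (e * r)] and the imaginary
   part at most [5 * (e * r)]; the bound [e <= 1] controls the factors [1 + x] and [1 + x + A]. *)
set (e := Rmin 1 (eps / 10)).
assert (e0 : (0 < e)%R) by (apply Rmin_pos; lra).
assert (e1 : (e <= 1)%R) by apply Rmin_l.
assert (e2 : (e <= eps / 10)%R) by apply Rmin_r.
clearbody e.
destruct (derivable_pt_lim_remainder exp 1) with (eps := e) as [d1 [p1 h1]]; auto.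
{ rewrite <- exp_0. apply derivable_pt_lim_exp. }
destruct (derivable_pt_lim_remainder cos 0) with (eps := e) as [d2 [p2 h2]]; auto.
{ replace 0%R with (- sin 0)%R at 2 by (rewrite sin_0; ring). apply derivable_pt_lim_cos. }
destruct (derivable_pt_lim_remainder sin 1) with (eps := e) as [d3 [p3 h3]]; auto.
{ rewrite <- cos_0. apply derivable_pt_lim_sin. }
rewrite exp_0 in h1. rewrite cos_0 in h2. rewrite sin_0 in h3.
exists (Rmin e (Rmin d1 (Rmin d2 d3))). split; [repeat apply Rmin_pos; auto|].
intros v hv.
assert (v0 := Rmin_l e (Rmin d1 (Rmin d2 d3))).
assert (v1 := Rmin_r e (Rmin d1 (Rmin d2 d3))).
assert (v2 := Rmin_l d1 (Rmin d2 d3)).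
assert (v3 := Rmin_r d1 (Rmin d2 d3)).
assert (v4 := Rmin_l d2 d3). assert (v5 := Rmin_r d2 d3).
assert (m := Rmax_Cmod v).
assert (m1 := Rle_trans _ _ _ (Rmax_l _ _) m).
assert (m2 := Rle_trans _ _ _ (Rmax_r _ _) m).
destruct v as [x y]. simpl in m1, m2.
specialize (h1 x ltac:(lra)). specialize (h2 y ltac:(lra)). specialize (h3 y ltac:(lra)).
apply Rle_trans with (1 := Cmod_le_sum _).
simpl fst; simpl snd.
set (r := Cmod (x, y)) in *.
assert (x0 := Rabs_pos x). assert (y0 := Rabs_pos y).
set (A := (exp x - 1 - 1 * x)%R) in *.
set (B := (cos y - 1 - 0 * y)%R) in *.
set (D := (sin y - 0 - 1 * y)%R) in *.
replace (exp x * cos y + -(1) + - x)%R with (A * cos y + (1 + x) * B)%R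
  by (unfold A, B; ring).
replace (exp x * sin y + -0 + - y)%R with ((1 + x + A) * D + y * (x + A))%R
  by (unfold A, D; ring).
assert (c1 : (Rabs (cos y) <= 1)%R) by (apply Rabs_le; generalize (COS_bound y); lra).
assert (q1 : (Rabs (A * cos y + (1 + x) * B) <= e * r + 2 * (e * r))%R).
{ apply Rle_trans with (1 := Rabs_triang _ _). rewrite !Rabs_mult.
  assert (k : (Rabs (1 + x) <= 2)%R).
  { apply Rle_trans with (1 := Rabs_triang _ _). rewrite Rabs_R1. lra. }
  apply Rplus_le_compat.
  - replace (e * r)%R with (e * r * 1)%R by ring.
    apply Rmult_le_compat; auto using Rabs_pos. nra.
  - apply Rmult_le_compat; auto using Rabs_pos. nra. }
assert (kA : (Rabs A <= e)%R) by nra.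
assert (q2 : (Rabs ((1 + x + A) * D + y * (x + A)) <= 3 * (e * r) + r * (2 * e))%R).
{ apply Rle_trans with (1 := Rabs_triang _ _). rewrite !Rabs_mult.
  assert (k : (Rabs (1 + x + A) <= 3)%R).
  { apply Rle_trans with (1 := Rabs_triang _ _).
    assert (Rabs (1 + x) <= 1 + Rabs x)%R.
    { apply Rle_trans with (1 := Rabs_triang _ _). rewrite Rabs_R1. lra. }
    lra. }
  apply Rplus_le_compat.
  - apply Rmult_le_compat; auto using Rabs_pos. nra.
  - apply Rmult_le_compat; auto using Rabs_pos.
    apply Rle_trans with (1 := Rabs_triang _ _). lra. }
assert (r0 : (0 <= r)%R) by apply Cmod_ge_0.
assert (8 * (e * r) <= eps * r)%R by nra.
lra.
Qed.

(** The arctangent of the slope is the argument only in the right half-plane, hence the hypothesis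
    [0 < fst w] in the lemmas below. *)
Definition Clog (w : C) : C := (ln (Cmod w), atan (snd w / fst w)).

Lemma cexp_Clog (w : C) : (0 < fst w)%R -> cexp (Clog w) = w.
Proof.
intros h. destruct w as [x y]. simpl in h.
assert (n : (x, y) <> RtoC 0) by (intro e; apply (f_equal fst) in e; simpl in e; lra).
assert (p := proj1 (Cmod_gt_0 _) n).
unfold cexp, Clog; simpl fst; simpl snd. rewrite exp_ln by auto.
assert (e : Cmod (x, y) = (x * sqrt (1 + (y / x)²))%R).
{ unfold Cmod; simpl fst; simpl snd. rewrite <- (sqrt_Rsqr x) at 2 by lra.
  rewrite <- sqrt_mult_alt by apply Rle_0_sqr. f_equal. unfold Rsqr. field. lra. }
assert (s : (0 < sqrt (1 + (y / x)²))%R).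
{ apply sqrt_lt_R0. generalize (Rle_0_sqr (y / x)); lra. }
rewrite cos_atan, sin_atan, e.
apply Ceq_components; simpl; field; lra.
Qed.

Lemma ccont_Clog (w : C) : (0 < fst w)%R -> ccont (U := C_UniformSpace) Clog w.
Proof.
intros h.
assert (n : w <> RtoC 0) by (intro e; apply (f_equal fst) in e; simpl in e; lra).
assert (p := proj1 (Cmod_gt_0 _) n).
assert (h1 := ccont_fst _ _ (ccont_id w)). assert (h2 := ccont_snd _ _ (ccont_id w)).
apply ccont_components; simpl.
- apply (continuous_comp (V := R_UniformSpace) (fun y : C_UniformSpace => Cmod y) ln).
  + unfold Cmod.
    apply (continuous_comp (V := R_UniformSpace)
      (fun y : C_UniformSpace => (fst y ^ 2 + snd y ^ 2)%R) sqrt).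
    * simpl. apply (continuous_plus (V := R_NormedModule));
      repeat (apply (continuous_mult (K := R_AbsRing)); [assumption|]);
      apply continuous_const.
    * apply continuous_sqrt.
  + now apply continuous_ln.
- apply (continuous_comp (V := R_UniformSpace)
      (fun y : C_UniformSpace => (snd y / fst y)%R) atan).
  + unfold Rdiv. apply (continuous_mult (K := R_AbsRing)); auto.
    apply (continuous_comp (V := R_UniformSpace) (fun y : C_UniformSpace => fst y) Rinv); auto.
    apply continuous_Rinv. lra.
  + apply continuous_atan.
Qed.

Lemma cderiv_cexp_0 : cderiv cexp 0 1.
Proof.
exists (fun v => if Ceq_dec v 0 then RtoC 1 else (cexp v - 1) / v).
split; [|split].
- apply ccont_of_ball. intros eps he.
  assert (he' : (0 < eps / 2)%R) by lra.
  destruct (cexp_remainder _ he') as [delta [pd hd]].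
  generalize (ccont_ball (U := C_UniformSpace) _ _ _ pd (ccont_id 0)).
  apply filter_imp. intros v hv. change C in v. simpl in hv.
  replace (v - 0) with v in hv by ring.
  destruct (Ceq_dec 0 0) as [_|k]; [|now elim k].
  destruct (Ceq_dec v 0) as [e|n].
  + replace (RtoC 1 - 1) with (RtoC 0) by ring. now rewrite Cmod_0.
  + replace ((cexp v - 1) / v - 1) with ((cexp v - 1 - v) / v) by (field; auto).
    rewrite Cmod_div by auto. specialize (hd v hv).
    assert (p := proj1 (Cmod_gt_0 _) n).
    apply Rle_lt_trans with (eps / 2)%R; [|lra].
    apply (Rmult_le_reg_r (Cmod v)); auto.
    unfold Rdiv at 1. rewrite Rmult_assoc, Rinv_l; lra.
- destruct (Ceq_dec 0 0) as [_|k]; [auto|now elim k].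
- apply filter_forall. intros v. change C in v. rewrite cexp_0.
  destruct (Ceq_dec v 0) as [e|n].
  + rewrite e, cexp_0. ring.
  + field; auto.
Qed.

Lemma locally_fst_pos (w : C) : (0 < fst w)%R ->
  locally (T := C_UniformSpace) w (fun v => (0 < fst v)%R).
Proof.
intros h. generalize (ccont_fst _ _ (ccont_id w)). intros hc.
apply (hc (fun x => (0 < x)%R)). now apply (open_gt 0).
Qed.

(* Inverse function rule: with [v = Clog w' - Clog w] and [exp v = 1 + v E(v)],
   one has [w' - w = w v E(v)], so the difference quotient of [Clog] is
   [1 / (w E(v))]. *)
Lemma cderiv_Clog (w : C) : (0 < fst w)%R -> cderiv Clog w (/ w).
Proof.
intros h.
assert (n : w <> RtoC 0) by (intro e; apply (f_equal fst) in e; simpl in e; lra).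
destruct cderiv_cexp_0 as [E [c1 [c2 c3]]].
set (d := fun v => Clog v - Clog w).
assert (dw : d w = 0) by (unfold d; ring).
assert (cd : ccont (U := C_UniformSpace) d w).
{ apply ccont_minus; [now apply ccont_Clog | apply ccont_const]. }
assert (cE : ccont (U := C_UniformSpace) (fun v => E (d v)) w).
{ apply (ccont_comp (U := C_UniformSpace) E d); auto. now rewrite dw. }
assert (nE : E (d w) <> 0) by (rewrite dw, c2; apply C1_nz).
exists (fun v => / (w * E (d v))). split; [|split].
- apply ccont_inv; [|now apply Cmult_neq_0].
  apply ccont_mult; auto; apply ccont_const.
- rewrite dw, c2. now rewrite Cmult_1_r.
- assert (c4 : locally (T := C_UniformSpace) w
    (fun v => cexp (d v) = cexp 0 + E (d v) * (d v - 0))).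
  { rewrite <- dw in c3 at 1. exact (cd _ c3). }
  generalize (filter_and _ _ (locally_fst_pos w h)
    (filter_and _ _ c4 (ccont_ne0 (U := C_UniformSpace) _ _ cE nE))).
  apply filter_imp. intros v [hv [e1 e2]]. change C in v.
  rewrite cexp_0 in e1.
  assert (e3 : cexp (d v) = v / w).
  { unfold d, Cminus. rewrite cexp_plus, cexp_opp, !cexp_Clog; auto. }
  rewrite e3 in e1.
  assert (e4 : v - w = w * (E (d v) * d v)).
  { replace v with (w * (v / w)) at 1 by (field; auto). rewrite e1. ring. }
  rewrite e4. replace (/ (w * E (d v)) * (w * (E (d v) * d v))) with (d v) by (field; auto).
  unfold d. ring.
Qed.

(** [Clog] settles the right half-plane; a quarter turn brings the imaginary axis there, and a half
    turn the left half-plane. *)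
Lemma cexp_surj (w : C) : w <> 0 -> exists v, cexp v = w.
Proof.
intros n.
assert (hi : cexp (0%R, (PI / 2)%R) = Ci).
{ apply Ceq_components; simpl; rewrite exp_0, ?cos_PI2, ?sin_PI2; ring. }
assert (h2 : forall u : C, u <> 0 -> (0 <= fst u)%R -> exists v, cexp v = u).
{ intros u nu [hu|hu]; [exists (Clog u); now apply cexp_Clog|].
  destruct (Rtotal_order (snd u) 0) as [hs|[hs|hs]].
  - exists (- (0%R, (PI / 2)%R) + Clog (Ci * u)).
    rewrite cexp_plus, cexp_opp, hi, cexp_Clog by (simpl; lra).
    field. apply Ci_nz.
  - elim nu. apply Ceq_components; auto.
  - exists ((0%R, (PI / 2)%R) + Clog (/ Ci * u)).
    rewrite cexp_plus, hi, cexp_Clog.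
    + field. apply Ci_nz.
    + rewrite Ci_inv; simpl; lra. }
destruct (Rle_dec 0 (fst w)) as [h|h]; auto.
destruct (h2 (- w)) as [v hv].
- intro e. apply n. replace w with (- - w) by ring. rewrite e. ring.
- simpl; lra.
- exists ((0%R, (PI / 2)%R) + (0%R, (PI / 2)%R) + v).
  rewrite !cexp_plus, hi, hv. apply Ceq_components; simpl; ring.
Qed.

(** * Goursat's theorem for a parallelogram *)

Definition CInt (f : R -> C) (a b : R) : C := RInt (V := C_R_CompleteNormedModule) f a b.

Definition ccont_on (f : R -> C) (a b : R) : Prop :=
  forall s, (a <= s <= b)%R -> ccont (U := R_UniformSpace) f s.

Lemma CInt_correct (f : R -> C) (a b : R) : (a <= b)%R -> ccont_on f a b ->
  is_RInt (V := C_R_NormedModule) f a b (CInt f a b).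
Proof.
intros hab h. apply (RInt_correct (V := C_R_CompleteNormedModule)).
apply (ex_RInt_continuous (V := C_R_CompleteNormedModule)).
intros z hz. rewrite Rmin_left, Rmax_right in hz by auto. now apply h.
Qed.

Lemma CInt_unique (f : R -> C) (a b : R) (l : C) :
  is_RInt (V := C_R_NormedModule) f a b l -> CInt f a b = l.
Proof. apply (is_RInt_unique (V := C_R_CompleteNormedModule)). Qed.

Lemma CInt_plus (f g : R -> C) (a b : R) : (a <= b)%R -> ccont_on f a b -> ccont_on g a b ->
  CInt (fun s => f s + g s) a b = CInt f a b + CInt g a b.
Proof.
intros hab hf hg. apply CInt_unique.
apply (is_RInt_plus (V := C_R_NormedModule)); now apply CInt_correct.
Qed.

(** The integral takes values in a real normed module, so a complex factor is moved out by working
    on real and imaginary parts. *)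
Lemma CInt_scal (c : C) (f : R -> C) (a b : R) : (a <= b)%R -> ccont_on f a b ->
  CInt (fun s => c * f s) a b = c * CInt f a b.
Proof.
intros hab hf. apply CInt_unique.
assert (h := CInt_correct f a b hab hf).
assert (h1 := is_RInt_fct_extend_fst (U := R_NormedModule) (V := R_NormedModule) _ _ _ _ h).
assert (h2 := is_RInt_fct_extend_snd (U := R_NormedModule) (V := R_NormedModule) _ _ _ _ h).
apply (is_RInt_fct_extend_pair (U := R_NormedModule) (V := R_NormedModule)); simpl.
- apply (is_RInt_minus (V := R_NormedModule)); now apply (is_RInt_scal (V := R_NormedModule)).
- apply (is_RInt_plus (V := R_NormedModule)); now apply (is_RInt_scal (V := R_NormedModule)).
Qed.

Lemma CInt_const (c : C) (a b : R) : CInt (fun _ => c) a b = RtoC (b - a) * c.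
Proof.
unfold CInt. rewrite (RInt_const (V := C_R_CompleteNormedModule)). apply scal_R_Cmult.
Qed.

Lemma CInt_Chasles (f : R -> C) (a b c : R) : (a <= b <= c)%R -> ccont_on f a c ->
  CInt f a b + CInt f b c = CInt f a c.
Proof.
intros h hf. symmetry. apply CInt_unique.
apply (is_RInt_Chasles (V := C_R_NormedModule) f a b c); apply CInt_correct; try lra;
  intros s hs; apply hf; lra.
Qed.

Lemma CInt_ext (f g : R -> C) (a b : R) : (a <= b)%R ->
  (forall s, (a <= s <= b)%R -> f s = g s) -> CInt f a b = CInt g a b.
Proof.
intros hab h. apply (RInt_ext (V := C_R_CompleteNormedModule)).
intros s hs. rewrite Rmin_left, Rmax_right in hs by auto. apply h; lra.
Qed.

Lemma CInt_bound (f : R -> C) (a b M : R) : (a <= b)%R -> ccont_on f a b ->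
  (forall s, (a <= s <= b)%R -> (Cmod (f s) <= M)%R) ->
  (Cmod (CInt f a b) <= (b - a) * M)%R.
Proof.
intros hab hf hM. rewrite Cmod_norm.
apply (norm_RInt_le_const (V := C_R_NormedModule) f a b (CInt f a b) M hab).
- intros s hs. rewrite <- Cmod_norm. now apply hM.
- now apply CInt_correct.
Qed.

(** Compactness of the unit square as an induction principle: a property of squares that survives
    gluing four quarters and holds for all small squares around each point holds for the whole.
    Otherwise, nested failing quarters would shrink to a point. It serves both Goursat's theorem and
    a uniform continuity argument. *)
Lemma square_bisection (P : R -> R -> R -> Prop) :
  (forall x y d, (0 < d)%R -> P x y d -> P (x + d)%R y d -> P x (y + d)%R d ->
     P (x + d)%R (y + d)%R d ->
     (0 <= x)%R -> (x + 2 * d <= 1)%R -> (0 <= y)%R -> (y + 2 * d <= 1)%R ->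
     P x y (2 * d)%R) ->
  (forall u v, (0 <= u <= 1)%R -> (0 <= v <= 1)%R -> exists delta, (0 < delta)%R /\
     forall x y d, (0 < d < delta)%R -> (0 <= x <= u)%R -> (u <= x + d <= 1)%R ->
       (0 <= y <= v)%R -> (v <= y + d <= 1)%R -> P x y d) ->
  P 0%R 0%R 1%R.
Proof.
intros hmerge hloc. apply NNPP. intros hn.
(* Picks a quarter on which [P] fails. The last one is taken untested: if the other three satisfy
   [P], gluing forces it to fail. *)
set (step := fun (d : R) (q : R * R) =>
  let (x, y) := q in
  if excluded_middle_informative (P x y d) then
  if excluded_middle_informative (P (x + d)%R y d) then
  if excluded_middle_informative (P x (y + d)%R d) then ((x + d)%R, (y + d)%R)
  else (x, (y + d)%R) else ((x + d)%R, y) else (x, y)).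
set (D := fun n : nat => ((/ 2) ^ n)%R).
set (S := fix S n := match n with O => (0%R, 0%R) | S k => step (D (Datatypes.S k)) (S k) end).
assert (hD : forall n, (0 < D n)%R) by (intro n; apply pow_lt; lra).
assert (hDS : forall n, D n = (2 * D (Datatypes.S n))%R).
{ intro n; unfold D; simpl. field. }
assert (hS : forall n, (0 <= fst (S n))%R /\ (fst (S n) + D n <= 1)%R /\
  (0 <= snd (S n))%R /\ (snd (S n) + D n <= 1)%R /\ ~ P (fst (S n)) (snd (S n)) (D n)).
{ induction n as [|n IH]; [unfold D; simpl; repeat split; (lra || exact hn)|].
  destruct IH as [a1 [a2 [a3 [a4 a5]]]]. simpl S.
  assert (q := hD (Datatypes.S n)). rewrite hDS in a2, a4, a5.
  destruct (S n) as [x y]. simpl in a1, a2, a3, a4, a5. unfold step.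
  destruct (excluded_middle_informative _) as [k1|k1]; simpl; [|repeat split; auto; lra].
  destruct (excluded_middle_informative _) as [k2|k2]; simpl; [|repeat split; auto; lra].
  destruct (excluded_middle_informative _) as [k3|k3]; simpl; [|repeat split; auto; lra].
  repeat split; auto; try lra. }
assert (hmono : forall n, (fst (S n) <= fst (S (Datatypes.S n)))%R /\
  (fst (S (Datatypes.S n)) + D (Datatypes.S n) <= fst (S n) + D n)%R /\
  (snd (S n) <= snd (S (Datatypes.S n)))%R /\
  (snd (S (Datatypes.S n)) + D (Datatypes.S n) <= snd (S n) + D n)%R).
{ intro n. rewrite (hDS n). assert (q := hD (Datatypes.S n)). simpl S.
  destruct (S n) as [x y]. unfold step.
  repeat (destruct (excluded_middle_informative _)); simpl; repeat split; lra. }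
assert (nested : forall f : nat -> R,
  (forall n, (f n <= f (Datatypes.S n))%R /\ (f (Datatypes.S n) + D (Datatypes.S n) <= f n + D n)%R) ->
  exists u, forall n, (f n <= u <= f n + D n)%R).
{ intros f hf.
  assert (up : forall n k, (f n <= f (n + k)%nat)%R /\ (f (n + k)%nat + D (n + k)%nat <= f n + D n)%R).
  { intros n k; induction k as [|k IH]; [rewrite Nat.add_0_r; lra|].
    rewrite Nat.add_succ_r. specialize (hf (n + k)%nat). lra. }
  (* Every left end lies below every right end, so the supremum of the left ends belongs to all the
     intervals. *)
  assert (cross : forall n k, (f k <= f n + D n)%R).
  { intros n k. assert (q1 := hD k). assert (q2 := hD n). destruct (Nat.le_ge_cases n k) as [l|l].
    - destruct (up n (k - n)%nat) as [b1 b2]. replace (n + (k - n))%nat with k in * by lia. lra.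
    - destruct (up k (n - k)%nat) as [b1 b2]. replace (k + (n - k))%nat with n in * by lia. lra. }
  destruct (completeness (fun r => exists k, r = f k)) as [u [hu1 hu2]].
  - exists (f O + D O)%R. intros r [k ->]. apply cross.
  - exists (f O), O; auto.
  - exists u. intro n. split; [apply hu1; eauto|]. apply hu2. intros r [k ->]. apply cross. }
destruct (nested (fun n => fst (S n))) as [u hu].
{ intro n; generalize (hmono n); tauto. }
destruct (nested (fun n => snd (S n))) as [v hv].
{ intro n; generalize (hmono n); tauto. }
assert (u01 := hu O). assert (v01 := hv O). unfold D in u01, v01. simpl in u01, v01.
destruct (hloc u v) as [delta [hd hP]]; [lra | lra |].
destruct (pow_lt_1_zero (/ 2)) with (y := delta) as [N hN]; [rewrite Rabs_pos_eq; lra | lra |].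
specialize (hN N (Nat.le_refl N)). rewrite Rabs_pos_eq in hN by (apply pow_le; lra).
destruct (hS N) as [a1 [a2 [a3 [a4 a5]]]]. apply a5.
specialize (hu N). specialize (hv N). assert (q := hD N).
apply hP; unfold D in *; lra.
Qed.

Definition pt (p w1 w2 : C) (s t : R) : C := p + RtoC s * w1 + RtoC t * w2.

Lemma Cmod_pt_dist (p w1 w2 : C) (s t u v r : R) :
  (Rabs (s - u) <= r)%R -> (Rabs (t - v) <= r)%R ->
  (Cmod (pt p w1 w2 s t - pt p w1 w2 u v) <= r * (Cmod w1 + Cmod w2))%R.
Proof.
intros hs ht. unfold pt.
replace (p + s * w1 + t * w2 - (p + u * w1 + v * w2)) with
  (RtoC (s - u) * w1 + RtoC (t - v) * w2) by (rewrite !RtoC_minus; ring).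
apply Rle_trans with (1 := Cmod_triangle _ _).
rewrite !Cmod_mult, !Cmod_R, Rmult_plus_distr_l.
apply Rplus_le_compat; (apply Rmult_le_compat_r; [apply Cmod_ge_0 | assumption]).
Qed.

Lemma ccont_pt_l (p w1 w2 : C) (s t : R) :
  ccont (U := R_UniformSpace) (fun s => pt p w1 w2 s t) s.
Proof.
unfold pt. repeat apply ccont_plus; try apply ccont_const.
apply ccont_mult; [|apply ccont_const]. apply ccont_RtoC, continuous_id.
Qed.

Lemma ccont_pt_r (p w1 w2 : C) (s t : R) :
  ccont (U := R_UniformSpace) (fun t => pt p w1 w2 s t) t.
Proof.
unfold pt. apply ccont_plus; [apply ccont_const|].
apply ccont_mult; [|apply ccont_const]. apply ccont_RtoC, continuous_id.
Qed.

(* The integral of [G dz], counterclockwise when [w2 / w1] has positive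
   imaginary part, around the image of the square [x, x+d] x [y, y+d]. *)
Definition contour (p w1 w2 : C) (G : C -> C) (x y d : R) : C :=
  w1 * (CInt (fun s => G (pt p w1 w2 s y)) x (x + d)
        - CInt (fun s => G (pt p w1 w2 s (y + d)%R)) x (x + d)) +
  w2 * (CInt (fun t => G (pt p w1 w2 (x + d)%R t)) y (y + d)
        - CInt (fun t => G (pt p w1 w2 x t)) y (y + d)).

(** The bound [eps * (2 * W * W) * (d * d)] is proportional to area, so it passes from four quarters
    to their union, and differentiability gives it for small squares around each point. Then [eps]
    tends to 0. *)
Lemma Goursat (p w1 w2 : C) (G : C -> C) :
  (forall s t, (0 <= s <= 1)%R -> (0 <= t <= 1)%R -> chol G (pt p w1 w2 s t)) ->
  contour p w1 w2 G 0 0 1 = 0.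
Proof.
intros hG.
assert (cl : forall a b t, (0 <= a)%R -> (b <= 1)%R -> (0 <= t <= 1)%R ->
  ccont_on (fun s => G (pt p w1 w2 s t)) a b).
{ intros a b t ha hb ht s hs. apply (ccont_comp G (fun s => pt p w1 w2 s t)).
  - apply ccont_pt_l.
  - apply chol_cont, hG; lra. }
assert (cr : forall a b s, (0 <= a)%R -> (b <= 1)%R -> (0 <= s <= 1)%R ->
  ccont_on (fun t => G (pt p w1 w2 s t)) a b).
{ intros a b s ha hb hs t ht. apply (ccont_comp G (fun t => pt p w1 w2 s t)).
  - apply ccont_pt_r.
  - apply chol_cont, hG; lra. }
set (W := (Cmod w1 + Cmod w2)%R).
assert (W0 : (0 <= W)%R) by (unfold W; generalize (Cmod_ge_0 w1) (Cmod_ge_0 w2); lra).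
assert (key : forall eps, (0 < eps)%R -> (Cmod (contour p w1 w2 G 0 0 1) <= eps * (2 * W * W))%R).
{ intros eps he.
  replace (eps * (2 * W * W))%R with (eps * (2 * W * W) * (1 * 1))%R by ring.
  apply (square_bisection
    (fun x y d => (Cmod (contour p w1 w2 G x y d) <= eps * (2 * W * W) * (d * d))%R)).
  - intros x y d hd h1 h2 h3 h4 x0 x1 y0 y1.
    (* Inner edges are traversed twice, in opposite directions, and cancel. *)
    assert (e : contour p w1 w2 G x y (2 * d)%R =
      contour p w1 w2 G x y d + contour p w1 w2 G (x + d)%R y d +
      (contour p w1 w2 G x (y + d)%R d + contour p w1 w2 G (x + d)%R (y + d)%R d)).
    { unfold contour.
      replace (x + d + d)%R with (x + 2 * d)%R by ring.
      replace (y + d + d)%R with (y + 2 * d)%R by ring.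
      rewrite <- (CInt_Chasles (fun s => G (pt p w1 w2 s y)) x (x + d) (x + 2 * d))
        by (try lra; apply cl; lra).
      rewrite <- (CInt_Chasles (fun s => G (pt p w1 w2 s (y + 2 * d)%R)) x (x + d) (x + 2 * d))
        by (try lra; apply cl; lra).
      rewrite <- (CInt_Chasles (fun t => G (pt p w1 w2 x t)) y (y + d) (y + 2 * d))
        by (try lra; apply cr; lra).
      rewrite <- (CInt_Chasles (fun t => G (pt p w1 w2 (x + 2 * d)%R t)) y (y + d) (y + 2 * d))
        by (try lra; apply cr; lra).
      ring. }
    rewrite e.
    apply Rle_trans with (1 := Cmod_triangle _ _).
    assert (t1 := Cmod_triangle (contour p w1 w2 G x y d) (contour p w1 w2 G (x + d)%R y d)).
    assert (t2 := Cmod_triangle (contour p w1 w2 G x (y + d)%R d)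
                   (contour p w1 w2 G (x + d)%R (y + d)%R d)).
    lra.
  - intros u v hu hv.
    destruct (hG u v hu hv) as [l [phi [f1 [f2 f3]]]].
    set (z0 := pt p w1 w2 u v) in *.
    assert (f4 := filter_and _ _ (ccont_ball (U := C_UniformSpace) phi z0 eps he f1) f3).
    apply locally_C in f4. destruct f4 as [eta heta].
    (* Points of a square of side [d] containing [(u, v)] are mapped within [d * W] of [z0]; the
       [+ 1] avoids dividing by zero. *)
    exists (eta / (W + 1))%R. split.
    { apply Rdiv_lt_0_compat; [apply cond_pos | lra]. }
    intros x y d hd hx1 hx2 hy1 hy2.
    assert (hdW : (d * W < eta)%R).
    { apply Rle_lt_trans with (d * (W + 1))%R; [nra|].
      apply (Rmult_lt_reg_r (/ (W + 1))); [apply Rinv_0_lt_compat; lra|].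
      rewrite Rmult_assoc, Rinv_r, Rmult_1_r by lra. apply hd. }
    (* The affine part [G z0 + l (z - z0)] has zero contour integral. *)
    assert (R0 : forall s t, (x <= s <= x + d)%R -> (y <= t <= y + d)%R ->
      (Cmod (G (pt p w1 w2 s t) - (G z0 + l * (pt p w1 w2 s t - z0))) <= eps * (d * W))%R).
    { intros s t hs ht.
      assert (hdist : (Cmod (pt p w1 w2 s t - z0) <= d * W)%R).
      { apply Cmod_pt_dist; apply Rabs_le; lra. }
      destruct (heta (pt p w1 w2 s t)) as [g1 g2].
      { apply (Rle_lt_trans _ (d * W)); auto. }
      rewrite g2.
      replace (G z0 + phi (pt p w1 w2 s t) * (pt p w1 w2 s t - z0) -
        (G z0 + l * (pt p w1 w2 s t - z0))) with
        ((phi (pt p w1 w2 s t) - phi z0) * (pt p w1 w2 s t - z0)) by (rewrite f2; ring).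
      rewrite Cmod_mult. apply Rmult_le_compat; try apply Cmod_ge_0; auto. lra. }
    (* Opposite sides are estimated together. On them the affine part differs by a constant, which
       [c] compensates; the compensations [l * d * w2] and [- (l * d * w1)] used in [b1] and [b2]
       cancel after multiplication by [w1 * d] and [w2 * d]. *)
    assert (est : forall (F1 F2 : R -> C) a c w, ccont_on F1 a (a + d) -> ccont_on F2 a (a + d) ->
       (forall s, (a <= s <= a + d)%R -> (Cmod (F1 s - F2 s + c) <= 2 * (eps * (d * W)))%R) ->
       (Cmod (w * (CInt F1 a (a + d) - CInt F2 a (a + d)) + w * RtoC d * c)
         <= Cmod w * (d * (2 * (eps * (d * W)))))%R).
    { intros F1 F2 a c w hF1 hF2 hb.
      assert (hF2' : ccont_on (fun s => RtoC (-1) * F2 s) a (a + d)).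
      { intros s hs. apply ccont_mult; [apply ccont_const | now apply hF2]. }
      replace (w * (CInt F1 a (a + d) - CInt F2 a (a + d)) + w * RtoC d * c) with
        (w * (CInt (fun s => F1 s + RtoC (-1) * F2 s + c) a (a + d))).
      2:{ rewrite CInt_plus, CInt_plus, CInt_scal, CInt_const; auto; try lra.
          - replace (a + d - a)%R with d by ring. ring.
          - intros s hs. apply ccont_plus; auto.
          - intros s hs. apply ccont_const. }
      rewrite Cmod_mult. apply Rmult_le_compat_l; [apply Cmod_ge_0|].
      replace d with (a + d - a)%R at 2 by ring.
      apply CInt_bound; [lra | |].
      - intros s hs. repeat apply ccont_plus; auto. apply ccont_const.
      - intros s hs. replace (F1 s + RtoC (-1) * F2 s + c) with (F1 s - F2 s + c) by ring.
        now apply hb. }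
    assert (b1 : (Cmod (w1 * (CInt (fun s => G (pt p w1 w2 s y)) x (x + d)
        - CInt (fun s => G (pt p w1 w2 s (y + d)%R)) x (x + d)) + w1 * RtoC d * (l * RtoC d * w2))
        <= Cmod w1 * (d * (2 * (eps * (d * W)))))%R).
    { apply est; [apply cl; lra | apply cl; lra |]. intros s hs.
      assert (r1 := R0 s y hs ltac:(lra)). assert (r2 := R0 s (y + d)%R hs ltac:(lra)).
      replace (G (pt p w1 w2 s y) - G (pt p w1 w2 s (y + d)%R) + l * RtoC d * w2) with
        ((G (pt p w1 w2 s y) - (G z0 + l * (pt p w1 w2 s y - z0))) +
        - (G (pt p w1 w2 s (y + d)%R) - (G z0 + l * (pt p w1 w2 s (y + d)%R - z0))))
        by (unfold pt; rewrite RtoC_plus; ring).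
      apply Rle_trans with (1 := Cmod_triangle _ _). rewrite Cmod_opp. lra. }
    assert (b2 : (Cmod (w2 * (CInt (fun t => G (pt p w1 w2 (x + d)%R t)) y (y + d)
        - CInt (fun t => G (pt p w1 w2 x t)) y (y + d)) + w2 * RtoC d * - (l * RtoC d * w1))
        <= Cmod w2 * (d * (2 * (eps * (d * W)))))%R).
    { apply est; [apply cr; lra | apply cr; lra |]. intros t ht.
      assert (r1 := R0 x t ltac:(lra) ht). assert (r2 := R0 (x + d)%R t ltac:(lra) ht).
      replace (G (pt p w1 w2 (x + d)%R t) - G (pt p w1 w2 x t) + - (l * RtoC d * w1)) with
        ((G (pt p w1 w2 (x + d)%R t) - (G z0 + l * (pt p w1 w2 (x + d)%R t - z0))) +
        - (G (pt p w1 w2 x t) - (G z0 + l * (pt p w1 w2 x t - z0))))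
        by (unfold pt; rewrite RtoC_plus; ring).
      apply Rle_trans with (1 := Cmod_triangle _ _). rewrite Cmod_opp. lra. }
    replace (contour p w1 w2 G x y d) with
      ((w1 * (CInt (fun s => G (pt p w1 w2 s y)) x (x + d)
        - CInt (fun s => G (pt p w1 w2 s (y + d)%R)) x (x + d)) + w1 * RtoC d * (l * RtoC d * w2)) +
      (w2 * (CInt (fun t => G (pt p w1 w2 (x + d)%R t)) y (y + d)
        - CInt (fun t => G (pt p w1 w2 x t)) y (y + d)) + w2 * RtoC d * - (l * RtoC d * w1)))
      by (unfold contour; ring).
    apply Rle_trans with (1 := Cmod_triangle _ _).
    apply Rle_trans with (Cmod w1 * (d * (2 * (eps * (d * W)))) + Cmod w2 * (d * (2 * (eps * (d * W)))))%R;
      [lra|].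
    unfold W. right. ring. }
apply Cmod_eq_0. apply Rle_antisym; [|apply Cmod_ge_0].
apply Rnot_lt_le. intros hpos.
set (I := Cmod (contour p w1 w2 G 0 0 1)) in *.
assert (K0 : (0 <= 2 * W * W)%R) by nra.
assert (he : (0 < I / (2 * (2 * W * W + 1)))%R) by (apply Rdiv_lt_0_compat; lra).
specialize (key _ he).
assert (e : (I / (2 * (2 * W * W + 1)) * (2 * W * W + 1) = I / 2)%R) by (field; lra).
nra.
Qed.

(** * Logarithm of a nonvanishing holomorphic function *)

(** Here |a - b| < |c|/2 < |b|, so a/b lies in the open unit disc around 1. *)
Lemma ratio_fst_pos (a b c : C) : c <> 0 ->
  (Cmod (a - c) < Cmod c / 4)%R -> (Cmod (b - c) < Cmod c / 4)%R ->
  (0 < fst (a * / b)%C)%R.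
Proof.
intros n ha hb. apply Cmod_gt_0 in n.
assert (hab : (Cmod (a - b) < Cmod c / 2)%R).
{ replace (a - b) with ((a - c) + - (b - c)) by ring.
  apply Rle_lt_trans with (1 := Cmod_triangle _ _). rewrite Cmod_opp. lra. }
assert (hb' : (Cmod c / 2 < Cmod b)%R).
{ assert (h : (Cmod c <= Cmod b + Cmod (b - c))%R).
  { replace c with (b + - (b - c)) at 1 by ring.
    apply Rle_trans with (1 := Cmod_triangle _ _). rewrite Cmod_opp. lra. }
  lra. }
assert (nb : b <> 0) by (apply Cmod_gt_0; lra).
assert (h1 : (Cmod (a * / b - 1) < 1)%R).
{ replace (a * / b - 1) with ((a - b) / b) by (field; auto).
  rewrite Cmod_div by auto.
  apply (Rmult_lt_reg_r (Cmod b)); [lra|].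
  unfold Rdiv. rewrite Rmult_assoc, Rinv_l; lra. }
assert (h2 := re_le_Cmod (a * / b - 1)). apply Rabs_le_between in h2.
unfold Re in h2. change (fst (a * / b - 1)%C) with (fst (a * / b)%C + - 1)%R in h2. lra.
Qed.

(** Gives a uniform step for the ray construction below: over shorter steps, the principal logarithm
    applies to the ratio of two values of [h]. *)
Lemma uniform_ratio_fst_pos (p w1 w2 : C) (h : C -> C) :
  (forall s t, (0 <= s <= 1)%R -> (0 <= t <= 1)%R -> chol h (pt p w1 w2 s t)) ->
  (forall s t, (0 <= s <= 1)%R -> (0 <= t <= 1)%R -> h (pt p w1 w2 s t) <> 0) ->
  exists eta, (0 < eta)%R /\
  forall s t s' t', (0 <= s <= 1)%R -> (0 <= t <= 1)%R ->
    (Rabs (s' - s) < eta)%R -> (Rabs (t' - t) < eta)%R ->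
    (0 < fst (h (pt p w1 w2 s' t') * / h (pt p w1 w2 s t))%C)%R.
Proof.
intros h_hol h_ne0.
set (P := fun x y d => exists eta, (0 < eta)%R /\
  forall s t s' t', (x <= s <= x + d)%R -> (y <= t <= y + d)%R ->
    (Rabs (s' - s) < eta)%R -> (Rabs (t' - t) < eta)%R ->
    (0 < fst (h (pt p w1 w2 s' t') * / h (pt p w1 w2 s t))%C)%R).
assert (H : P 0%R 0%R 1%R).
{ apply square_bisection.
  - intros x y d hd [e1 [p1 h1]] [e2 [p2 h2]] [e3 [p3 h3]] [e4 [p4 h4]] _ _ _ _.
    (* Only [(s, t)] is confined to the square, not [(s', t')], so the smallest of the four moduli
       works even for pairs that straddle two quarters. *)
    exists (Rmin (Rmin e1 e2) (Rmin e3 e4)). split; [repeat apply Rmin_pos; auto|].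
    intros s t s' t' hs ht ds dt.
    assert (m1 := Rmin_l (Rmin e1 e2) (Rmin e3 e4)).
    assert (m2 := Rmin_r (Rmin e1 e2) (Rmin e3 e4)).
    assert (m3 := Rmin_l e1 e2). assert (m4 := Rmin_r e1 e2).
    assert (m5 := Rmin_l e3 e4). assert (m6 := Rmin_r e3 e4).
    destruct (Rle_dec s (x + d)) as [a|a]; destruct (Rle_dec t (y + d)) as [b|b].
    + apply h1; lra.
    + apply h3; lra.
    + apply h2; lra.
    + apply h4; lra.
  - intros u v hu hv. set (z0 := pt p w1 w2 u v).
    assert (n0 := h_ne0 u v hu hv). fold z0 in n0.
    assert (q0 := proj1 (Cmod_gt_0 _) n0).
    assert (hc := chol_cont _ _ (h_hol u v hu hv)). fold z0 in hc.
    apply (ccont_ball (U := C_UniformSpace) _ _ (Cmod (h z0) / 4)) in hc; [|lra].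
    apply locally_C in hc. destruct hc as [eta heta].
    set (W := (Cmod w1 + Cmod w2)%R).
    assert (W0 : (0 <= W)%R) by (unfold W; generalize (Cmod_ge_0 w1) (Cmod_ge_0 w2); lra).
    (* The factor 2: [(s, t)] is within [delta] of [(u, v)], and [(s', t')] within a further
       [delta]. *)
    set (delta := (eta / (2 * (W + 1)))%R).
    assert (hd : (0 < delta)%R) by (apply Rdiv_lt_0_compat; [apply cond_pos | lra]).
    assert (hdW : (2 * delta * W < eta)%R).
    { assert (e : (2 * delta * (W + 1) = eta)%R) by (unfold delta; field; lra). nra. }
    assert (near : forall s t, (Rabs (s - u) <= 2 * delta)%R -> (Rabs (t - v) <= 2 * delta)%R ->
      (Cmod (h (pt p w1 w2 s t) - h z0) < Cmod (h z0) / 4)%R).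
    { intros s t hs ht. apply heta.
      apply (Rle_lt_trans _ (2 * delta * W)); auto. now apply Cmod_pt_dist. }
    exists delta. split; auto. intros x y d hdd hx1 hx2 hy1 hy2.
    exists delta. split; auto. intros s t s' t' hs ht ds dt.
    apply Rabs_lt_between in ds. apply Rabs_lt_between in dt.
    apply ratio_fst_pos with (h z0); auto; apply near; apply Rabs_le; lra. }
destruct H as [eta [p1 h1]]. exists eta; split; auto.
intros s t s' t' hs ht. apply h1; lra.
Qed.

Definition ray (p : C) (r : R) (z : C) : C := p + RtoC r * (z - p).

Lemma ray_pt (p w1 w2 : C) (r s t : R) : ray p r (pt p w1 w2 s t) = pt p w1 w2 (r * s) (r * t).
Proof. unfold ray, pt. rewrite !RtoC_mult. ring. Qed.

Lemma chol_ray (p : C) (r : R) (z : C) : chol (ray p r) z.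
Proof.
unfold ray. apply chol_plus; [apply chol_const|]. apply chol_mult; [apply chol_const|].
apply chol_minus; [apply chol_id | apply chol_const].
Qed.

(* Along the segment from [p] to [z], consecutive ratios of values of [h] lie
   in the right half-plane; the sum of their principal logarithms telescopes. *)
Fixpoint log_along_ray (p : C) (h : C -> C) (r : R) (n : nat) (z : C) : C :=
  match n with
  | O => 0
  | S k => log_along_ray p h r k z + Clog (h (ray p (r * INR (S k)) z) * / h (ray p (r * INR k) z))
  end.

(** The parallelogram is star-shaped about [p], so every ray stays where [h] is holomorphic and
    nonzero. The number of steps is the same for all points, so the sum of logarithms is holomorphic
    in the endpoint. *)
Lemma holomorphic_log (p w1 w2 : C) (h : C -> C) :
  (forall s t, (0 <= s <= 1)%R -> (0 <= t <= 1)%R -> chol h (pt p w1 w2 s t)) ->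
  (forall s t, (0 <= s <= 1)%R -> (0 <= t <= 1)%R -> h (pt p w1 w2 s t) <> 0) ->
  exists L : C -> C,
  forall s t, (0 <= s <= 1)%R -> (0 <= t <= 1)%R ->
    chol L (pt p w1 w2 s t) /\ cexp (L (pt p w1 w2 s t)) = h (pt p w1 w2 s t).
Proof.
intros h_hol h_ne0.
destruct (uniform_ratio_fst_pos p w1 w2 h h_hol h_ne0) as [eta [heta hpos]].
(* With [S N] steps, the coordinates along a ray change by at most [r = / INR (S N) < eta] from one
   step to the next. *)
destruct (nfloor_ex (/ eta)) as [N hN]; [left; now apply Rinv_0_lt_compat|].
assert (N0 : (0 < INR (S N))%R) by (apply lt_0_INR; lia).
set (r := (/ INR (S N))%R).
assert (r0 : (0 < r)%R) by now apply Rinv_0_lt_compat.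
assert (hr : (r < eta)%R).
{ unfold r. rewrite <- (Rinv_inv eta). apply Rinv_lt_contravar.
  - apply Rmult_lt_0_compat; auto. now apply Rinv_0_lt_compat.
  - rewrite S_INR. lra. }
assert (rN : (r * INR (S N) = 1)%R) by (unfold r; field; lra).
assert (p_eq : pt p w1 w2 0 0 = p) by (unfold pt; ring).
assert (np : h p <> 0) by (rewrite <- p_eq; apply h_ne0; lra).
destruct (cexp_surj (h p) np) as [c hc].
assert (ind : forall n s t, (n <= S N)%nat -> (0 <= s <= 1)%R -> (0 <= t <= 1)%R ->
  chol (log_along_ray p h r n) (pt p w1 w2 s t) /\
  cexp (c + log_along_ray p h r n (pt p w1 w2 s t)) = h (ray p (r * INR n) (pt p w1 w2 s t))).
{ induction n as [|n IH]; intros s t hn hs ht.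
  - simpl. split; [apply chol_const|].
    rewrite ray_pt, Rmult_0_r, !Rmult_0_l, p_eq, Cplus_0_r. exact hc.
  - destruct (IH s t ltac:(lia) hs ht) as [a1 a2].
    assert (k0 : (0 <= r * INR n)%R) by (apply Rmult_le_pos; [lra | apply pos_INR]).
    assert (k1 : (r * INR (S n) <= 1)%R).
    { rewrite <- rN. apply Rmult_le_compat_l; [lra|]. now apply le_INR. }
    assert (kS : (r * INR (S n) = r * INR n + r)%R) by (rewrite S_INR; ring).
    assert (b : forall q x, (0 <= q <= 1)%R -> (0 <= x <= 1)%R -> (0 <= q * x <= 1)%R) by (intros; nra).
    assert (b1 := b (r * INR n)%R s ltac:(lra) hs). assert (b2 := b (r * INR n)%R t ltac:(lra) ht).
    assert (b3 := b (r * INR (S n))%R s ltac:(lra) hs). assert (b4 := b (r * INR (S n))%R t ltac:(lra) ht).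
    assert (pos : (0 < fst (h (ray p (r * INR (S n)) (pt p w1 w2 s t)) *
                    / h (ray p (r * INR n) (pt p w1 w2 s t)))%C)%R).
    { rewrite !ray_pt. apply hpos; auto; rewrite kS; apply Rabs_lt_between; nra. }
    assert (nz : h (ray p (r * INR n) (pt p w1 w2 s t)) <> 0).
    { rewrite ray_pt. now apply h_ne0. }
    assert (holr : forall m, (m = n \/ m = S n) ->
      chol (fun z => h (ray p (r * INR m) z)) (pt p w1 w2 s t)).
    { intros m hm. apply (chol_comp h); [apply chol_ray|].
      rewrite ray_pt. destruct hm; subst m; now apply h_hol. }
    split.
    + change (chol (fun z => log_along_ray p h r n z +
        Clog (h (ray p (r * INR (S n)) z) * / h (ray p (r * INR n) z))) (pt p w1 w2 s t)).
      apply chol_plus; auto.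
      apply (chol_comp Clog).
      * apply chol_mult; [|apply chol_inv; auto]; apply holr; auto.
      * eexists. now apply cderiv_Clog.
    + change (cexp (c + (log_along_ray p h r n (pt p w1 w2 s t) +
        Clog (h (ray p (r * INR (S n)) (pt p w1 w2 s t)) *
          / h (ray p (r * INR n) (pt p w1 w2 s t))))) =
        h (ray p (r * INR (S n)) (pt p w1 w2 s t))).
      rewrite Cplus_assoc, cexp_plus, a2.
      rewrite cexp_Clog by assumption. field; auto. }
exists (fun z => c + log_along_ray p h r (S N) z).
intros s t hs ht. destruct (ind (S N) s t (Nat.le_refl _) hs ht) as [i1 i2].
split; [apply chol_plus; auto; apply chol_const|].
rewrite i2, rN, ray_pt. now rewrite !Rmult_1_l.
Qed.

(** * Logarithm of a linear factor along a line *)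

Lemma is_derive_along_line (F : C -> C) (q w l : C) (s : R) :
  cderiv F (q + RtoC s * w) l ->
  is_derive (K := R_AbsRing) (V := C_R_NormedModule) (fun s => F (q + RtoC s * w)) s (w * l).
Proof.
intros [phi [h1 [h2 h3]]].
assert (cg : ccont (U := R_UniformSpace) (fun s => q + RtoC s * w) s).
{ apply ccont_plus; [apply ccont_const|]. apply ccont_mult; [|apply ccont_const].
  apply ccont_RtoC, continuous_id. }
assert (cp : ccont (U := R_UniformSpace) (fun s => w * phi (q + RtoC s * w)) s).
{ apply ccont_mult; [apply ccont_const|]. now apply (ccont_comp phi (fun s : R => q + RtoC s * w)). }
assert (h4 : locally (T := R_UniformSpace) s (fun y => F (q + RtoC y * w) =
  F (q + RtoC s * w) + phi (q + RtoC y * w) * (q + RtoC y * w - (q + RtoC s * w))))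
  by exact (cg _ h3).
split; [apply is_linear_scal_l|].
intros x hx eps.
assert (e : x = s) by (symmetry; now apply (is_filter_lim_locally_unique (V := R_NormedModule))). subst x.
generalize (filter_and _ _ h4 (ccont_ball _ _ eps (cond_pos eps) cp)).
apply filter_imp. intros y [a b]. change R in y.
rewrite <- Cmod_norm. rewrite a.
change (scal (minus y s) (w * l)) with (scal (V := C_R_ModuleSpace) (y - s)%R (w * l)).
rewrite scal_R_Cmult.
match goal with |- (Cmod ?u <= _)%R => replace u with
  ((w * phi (q + RtoC y * w) - w * phi (q + RtoC s * w)) * RtoC (y - s)) end.
2:{ unfold minus, plus, opp; simpl.
    change ((w * phi (q + RtoC y * w) - w * phi (q + RtoC s * w)) * RtoC (y - s) =
     F (q + s * w) + phi (q + y * w) * (q + y * w - (q + s * w)) + - F (q + s * w) +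
     - (RtoC (y - s) * (w * l))).
    rewrite h2, RtoC_minus. ring. }
rewrite Cmod_mult, Cmod_R.
apply Rmult_le_compat_r; [apply Rabs_pos|]. lra.
Qed.

Lemma CInt_along_line (F G : C -> C) (q w : C) :
  (forall s, (0 <= s <= 1)%R -> cderiv F (q + RtoC s * w) (G (q + RtoC s * w))) ->
  ccont_on (fun s => G (q + RtoC s * w)) 0 1 ->
  w * CInt (fun s => G (q + RtoC s * w)) 0 1 = F (q + w) - F q.
Proof.
intros hF hG.
assert (hwG : ccont_on (fun s => w * G (q + RtoC s * w)) 0 1).
{ intros s hs. apply ccont_mult; [apply ccont_const | now apply hG]. }
rewrite <- CInt_scal by (auto; lra).
apply CInt_unique.
replace (F (q + w) - F q) with
  (minus (G := C_R_NormedModule) (F (q + RtoC 1 * w)) (F (q + RtoC 0 * w))).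
2:{ change (F (q + RtoC 1 * w) - F (q + RtoC 0 * w) = F (q + w) - F q).
    now rewrite Cmult_1_l, Cmult_0_l, Cplus_0_r. }
apply (is_RInt_derive (V := C_R_CompleteNormedModule) (fun s => F (q + RtoC s * w))).
- intros s hs. rewrite Rmin_left, Rmax_right in hs by lra.
  apply is_derive_along_line; auto.
- intros s hs. rewrite Rmin_left, Rmax_right in hs by lra. apply hwG; auto.
Qed.

(* On a line through [q] with direction [w] that misses [a], the multiple
   [sg i / w] of [z - a] has constant real part; when this is positive, the
   principal logarithm applies all along the line. *)
Lemma line_log (q w a : C) (sg : R) :
  (sg = 1 \/ sg = -1)%R -> w <> 0 -> (0 < fst (RtoC sg * Ci / w * (q - a))%C)%R ->
  exists l : R -> C, ccont_on l 0 1 /\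
    (forall s, (0 <= s <= 1)%R -> cexp (l s) = q + RtoC s * w - a) /\
    w * CInt l 0 1 = (q + w - a) * l 1%R - (q - a) * l 0%R - w /\
    (0 < sg * (snd (l 1%R) - snd (l 0%R)) < PI)%R.
Proof.
intros hsg hw hpos.
assert (hsg0 : RtoC sg <> 0).
{ intro e. apply RtoC_inj in e. lra. }
set (k := RtoC sg * Ci / w) in *.
assert (k0 : k <> 0).
{ unfold k, Cdiv. repeat apply Cmult_neq_0; auto; [apply Ci_nz|].
  intro e. apply C1_nz. rewrite <- (Cinv_l w hw), e. ring. }
(* In the rotated and scaled coordinate, the line becomes vertical. *)
assert (kw : forall s, k * (q + RtoC s * w - a) = k * (q - a) + RtoC (s * sg) * Ci).
{ intro s. unfold k. rewrite RtoC_mult. field; auto. }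
assert (kpos : forall s, (0 < fst (k * (q + RtoC s * w - a))%C)%R).
{ intro s. rewrite kw. change (0 < fst (k * (q - a))%C + fst (RtoC (s * sg) * Ci)%C)%R.
  replace (fst (RtoC (s * sg) * Ci)%C) with 0%R by (simpl; ring). lra. }
(* Adding a logarithm of [/ k] undoes the factor [k] inside [Clog]. *)
destruct (cexp_surj (/ k)) as [al hal].
{ intro e. apply C1_nz. rewrite <- (Cinv_l k k0), e. ring. }
set (G := fun z => al + Clog (k * (z - a))).
assert (dG : forall z, (0 < fst (k * (z - a))%C)%R -> cderiv G z (0 + / (k * (z - a)) * (0 * (z - a) + k * (1 + - (0))))).
{ intros z hz. unfold G. apply cderiv_plus; [apply cderiv_const|].
  apply (cderiv_comp Clog (fun z => k * (z - a))).
  - apply (cderiv_mult (fun _ => k) (fun z => z - a)); [apply cderiv_const|].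
    apply (cderiv_ext_loc (fun z => z + - a)).
    + apply filter_forall. intro y. reflexivity.
    + apply cderiv_plus; [apply cderiv_id|].
      replace (- (0)) with (RtoC 0) by ring. apply cderiv_const.
  - now apply cderiv_Clog. }
assert (eG : forall s, cexp (G (q + RtoC s * w)) = q + RtoC s * w - a).
{ intro s. unfold G. rewrite cexp_plus, hal, cexp_Clog by auto. field; auto. }
assert (cG : ccont_on (fun s => G (q + RtoC s * w)) 0 1).
{ intros s _. apply (ccont_comp G (fun s : R => q + RtoC s * w)).
  - apply ccont_plus; [apply ccont_const|]. apply ccont_mult; [|apply ccont_const].
    apply ccont_RtoC, continuous_id.
  - eapply cderiv_cont. now apply dG. }
exists (fun s => G (q + RtoC s * w)). split; [|split; [|split]]; auto.
- rewrite (CInt_along_line (fun z => (z - a) * G z + RtoC (-1) * z) G q w); auto.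
  + rewrite !Cmult_0_l, Cmult_1_l, Cplus_0_r. ring.
  + intros s hs. set (z := q + RtoC s * w).
    assert (nz : k * (z - a) <> 0).
    { intro e. specialize (kpos s). fold z in kpos. rewrite e in kpos. simpl in kpos. lra. }
    assert (nz' : z - a <> 0) by (intro e; apply nz; rewrite e; ring).
    assert (d2 := dG z (kpos s)).
    assert (d3 : cderiv (fun z => z - a) z (1 + 0)).
    { apply (cderiv_ext_loc (fun z => z + - a)).
      + apply filter_forall. intro y. reflexivity.
      + apply cderiv_plus; [apply cderiv_id|]. apply cderiv_const. }
    assert (d4 := cderiv_mult _ _ _ _ _ (cderiv_const (RtoC (-1)) z) (cderiv_id z)).
    assert (d5 := cderiv_plus _ _ _ _ _ (cderiv_mult _ _ _ _ _ d3 d2) d4).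
    match type of d5 with cderiv _ _ ?v => replace (G z) with v; [exact d5|] end.
    field. split; auto.
- set (c := fst (k * (q - a))%C) in *.
  (* The real part [c] is fixed, so the argument is an arctangent monotone in [s], in the direction
     of [sg]; the bounds of [atan] keep the total change below [PI]. *)
  assert (im : forall s, snd (G (q + RtoC s * w)) =
     (snd al + atan ((snd (k * (q - a))%C + s * sg) / c))%R).
  { intro s. unfold G. rewrite kw. unfold Clog.
    change (snd (al + ?u)) with (snd al + snd u)%R.
    simpl snd at 2. f_equal. f_equal. f_equal.
    - change (snd (k * (q - a))%C + snd (RtoC (s * sg) * Ci)%C =
        snd (k * (q - a))%C + s * sg)%R. simpl. ring.
    - change (c + fst (RtoC (s * sg) * Ci)%C = c)%R. simpl. ring. }
  rewrite !im.
  set (v := snd (k * (q - a))%C).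
  assert (ic : (0 < / c)%R) by now apply Rinv_0_lt_compat.
  assert (b1 := atan_bound ((v + 1 * sg) / c)). assert (b0 := atan_bound ((v + 0 * sg) / c)).
  destruct hsg as [-> | ->].
  + assert (i := atan_increasing ((v + 0 * 1) / c) ((v + 1 * 1) / c)).
    assert (j : ((v + 0 * 1) / c < (v + 1 * 1) / c)%R) by (apply Rmult_lt_compat_r; lra).
    specialize (i j). lra.
  + assert (i := atan_increasing ((v + 1 * -1) / c) ((v + 0 * -1) / c)).
    assert (j : ((v + 1 * -1) / c < (v + 0 * -1) / c)%R) by (apply Rmult_lt_compat_r; lra).
    specialize (i j). lra.
Qed.

(** * Moments of a logarithm on the boundary *)

(* [B], [T], [L], [R] are continuous logarithms of [F] on the bottom, top, left
   and right sides of the parallelogram; they need not agree at the corners.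
   [k] counts the zeros and [j] is their sum, when read off the contour
   integrals of [dlog F] and of [z dlog F], the latter integrated by parts. *)
Definition log_moments (p w1 w2 : C) (F : C -> C) (k j : C) : Prop :=
  exists B T L R : R -> C,
    (ccont_on B 0 1 /\ ccont_on T 0 1 /\ ccont_on L 0 1 /\ ccont_on R 0 1) /\
    (forall s, (0 <= s <= 1)%R ->
      cexp (B s) = F (pt p w1 w2 s 0) /\ cexp (T s) = F (pt p w1 w2 s 1) /\
      cexp (L s) = F (pt p w1 w2 0 s) /\ cexp (R s) = F (pt p w1 w2 1 s)) /\
    (B 1%R - B 0%R) - (T 1%R - T 0%R) + ((R 1%R - R 0%R) - (L 1%R - L 0%R))
      = k * two_pi_i /\
    w1 * (CInt B 0 1 - CInt T 0 1) + w2 * (CInt R 0 1 - CInt L 0 1) = j * two_pi_i.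

Lemma log_moments_mult (p w1 w2 : C) (F G : C -> C) (k j k' j' : C) :
  log_moments p w1 w2 F k j -> log_moments p w1 w2 G k' j' ->
  log_moments p w1 w2 (fun z => F z * G z) (k + k') (j + j').
Proof.
intros [B [T [L [R [[c1 [c2 [c3 c4]]] [h [hk hj]]]]]]].
intros [B' [T' [L' [R' [[c1' [c2' [c3' c4']]] [h' [hk' hj']]]]]]].
exists (fun s => B s + B' s), (fun s => T s + T' s), (fun s => L s + L' s),
  (fun s => R s + R' s). split; [|split; [|split]].
- repeat split; intros s hs; apply ccont_plus; auto.
- intros s hs. destruct (h s hs) as [e1 [e2 [e3 e4]]]. destruct (h' s hs) as [f1 [f2 [f3 f4]]].
  rewrite !cexp_plus. repeat split; congruence.
- rewrite Cmult_plus_distr_r, <- hk, <- hk'. ring.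
- rewrite !CInt_plus by (auto; lra). rewrite Cmult_plus_distr_r, <- hj, <- hj'. ring.
Qed.

(** At least one of the two natural exponents is 0, so zeros and poles are treated by one
    formula. *)
Definition zpow (z : C) (m : Z) : C := z ^ Z.to_nat m * / z ^ Z.to_nat (- m).

Lemma cexp_nat_mult (u : C) (n : nat) : cexp (RtoC (INR n) * u) = cexp u ^ n.
Proof.
induction n as [|n IH].
- simpl. rewrite Cmult_0_l. apply cexp_0.
- rewrite S_INR, RtoC_plus, Cmult_plus_distr_r, Cmult_1_l, cexp_plus, IH.
  simpl. ring.
Qed.

Lemma cexp_Z_mult (u : C) (m : Z) : cexp (RtoC (IZR m) * u) = zpow (cexp u) m.
Proof.
unfold zpow.
replace (RtoC (IZR m) * u) with
  (RtoC (INR (Z.to_nat m)) * u + - (RtoC (INR (Z.to_nat (- m))) * u)).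
- rewrite cexp_plus, cexp_opp, !cexp_nat_mult. reflexivity.
- rewrite !INR_IZR_INZ. replace m with (Z.of_nat (Z.to_nat m) - Z.of_nat (Z.to_nat (- m)))%Z at 3 by lia.
  rewrite minus_IZR, RtoC_minus. ring.
Qed.

Lemma log_moments_zpow (p w1 w2 : C) (F : C -> C) (k j : C) (m : Z) :
  log_moments p w1 w2 F k j ->
  log_moments p w1 w2 (fun z => zpow (F z) m) (RtoC (IZR m) * k) (RtoC (IZR m) * j).
Proof.
intros [B [T [L [R [[c1 [c2 [c3 c4]]] [h [hk hj]]]]]]].
exists (fun s => RtoC (IZR m) * B s), (fun s => RtoC (IZR m) * T s),
  (fun s => RtoC (IZR m) * L s), (fun s => RtoC (IZR m) * R s).
split; [|split; [|split]].
- repeat split; intros s hs; (apply ccont_mult; [apply ccont_const|]); auto.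
- intros s hs. destruct (h s hs) as [e1 [e2 [e3 e4]]].
  rewrite !cexp_Z_mult. repeat split; congruence.
- rewrite <- Cmult_assoc, <- hk. ring.
- rewrite !CInt_scal by (auto; lra). rewrite <- Cmult_assoc, <- hj. ring.
Qed.

(** Agreement on the boundary suffices. This lets the factorisation replace [f], since it may break
    down at zeros and poles inside. *)
Lemma log_moments_ext (p w1 w2 : C) (F G : C -> C) (k j : C) :
  (forall s, (0 <= s <= 1)%R ->
    F (pt p w1 w2 s 0) = G (pt p w1 w2 s 0) /\ F (pt p w1 w2 s 1) = G (pt p w1 w2 s 1) /\
    F (pt p w1 w2 0 s) = G (pt p w1 w2 0 s) /\ F (pt p w1 w2 1 s) = G (pt p w1 w2 1 s)) ->
  log_moments p w1 w2 F k j -> log_moments p w1 w2 G k j.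
Proof.
intros e [B [T [L [R [hc [h hkj]]]]]]. exists B, T, L, R. split; [|split]; auto.
intros s hs. destruct (h s hs) as [e1 [e2 [e3 e4]]]. destruct (e s hs) as [f1 [f2 [f3 f4]]].
repeat split; congruence.
Qed.

(** One logarithm on the whole parallelogram restricts to all four sides: its increments cancel at
    the corners, and its contour integral vanishes. *)
Lemma log_moments_nonvanishing (p w1 w2 : C) (h : C -> C) :
  (forall s t, (0 <= s <= 1)%R -> (0 <= t <= 1)%R -> chol h (pt p w1 w2 s t)) ->
  (forall s t, (0 <= s <= 1)%R -> (0 <= t <= 1)%R -> h (pt p w1 w2 s t) <> 0) ->
  log_moments p w1 w2 h 0 0.
Proof.
intros h1 h2. destruct (holomorphic_log p w1 w2 h h1 h2) as [L hL].
assert (g := Goursat p w1 w2 L (fun s t hs ht => proj1 (hL s t hs ht))).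
assert (cL : forall s t, (0 <= s <= 1)%R -> (0 <= t <= 1)%R ->
  ccont (U := C_UniformSpace) L (pt p w1 w2 s t)).
{ intros s t hs ht. apply chol_cont, hL; auto. }
exists (fun s => L (pt p w1 w2 s 0)), (fun s => L (pt p w1 w2 s 1)),
  (fun s => L (pt p w1 w2 0 s)), (fun s => L (pt p w1 w2 1 s)).
split; [|split; [|split]].
- repeat split; intros s hs.
  + apply (ccont_comp L (fun s => pt p w1 w2 s 0)); [apply ccont_pt_l | apply cL; lra].
  + apply (ccont_comp L (fun s => pt p w1 w2 s 1)); [apply ccont_pt_l | apply cL; lra].
  + apply (ccont_comp L (fun s => pt p w1 w2 0 s)); [apply ccont_pt_r | apply cL; lra].
  + apply (ccont_comp L (fun s => pt p w1 w2 1 s)); [apply ccont_pt_r | apply cL; lra].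
- intros s hs. repeat split; apply hL; lra.
- ring.
- unfold contour in g. rewrite !Rplus_0_l in g. rewrite g. ring.
Qed.

Lemma snd_inv_pos (u : C) : (snd u < 0)%R -> (0 < snd (/ u)%C)%R.
Proof.
intros h. assert (d0 : (0 < fst u ^ 2 + snd u ^ 2)%R) by nra.
apply Rinv_0_lt_compat in d0.
change (snd (/ u)) with (- snd u * / (fst u ^ 2 + snd u ^ 2))%R. nra.
Qed.

Lemma snd_inv_neg (u : C) : (0 < snd u)%R -> (snd (/ u)%C < 0)%R.
Proof.
intros h. assert (d0 : (0 < fst u ^ 2 + snd u ^ 2)%R) by nra.
apply Rinv_0_lt_compat in d0.
change (snd (/ u)) with (- snd u * / (fst u ^ 2 + snd u ^ 2))%R. nra.
Qed.

Lemma snd_scal_l (r : R) (w : C) : snd (RtoC r * w)%C = (r * snd w)%R.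
Proof. simpl. ring. Qed.

(** The sign [sg] of [line_log] is 1 on the bottom and right sides, and -1 on the top and left ones,
    which are parametrised against the counterclockwise orientation. Seen from the interior point,
    each side then turns counterclockwise by an angle strictly between 0 and pi. *)
Lemma log_moments_linear (p w1 w2 : C) (s0 t0 : R) :
  w1 <> 0 -> w2 <> 0 -> (0 < snd (w2 / w1)%C)%R -> (0 < s0 < 1)%R -> (0 < t0 < 1)%R ->
  exists lam, lattice w1 w2 lam /\
    log_moments p w1 w2 (fun z => z - pt p w1 w2 s0 t0) 1 (p - pt p w1 w2 s0 t0 + lam).
Proof.
intros n1 n2 hw hs0 ht0. set (a := pt p w1 w2 s0 t0).
assert (hw' : (snd (w1 / w2)%C < 0)%R).
{ replace (w1 / w2) with (/ (w2 / w1)) by (field; auto).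
  now apply snd_inv_neg. }
assert (fstCi : forall u v : R, forall w : C, fst (RtoC u * Ci * (RtoC v + w))%C = (- u * snd w)%R).
{ intros u v w. simpl. ring. }
destruct (line_log p w1 a 1) as [B [cB [eB [jB kB]]]]; auto.
{ replace (RtoC 1 * Ci / w1 * (p - a)) with (RtoC 1 * Ci * (RtoC (- s0) + RtoC (- t0) * (w2 / w1)))
    by (unfold a, pt; rewrite !RtoC_opp; field; auto).
  rewrite fstCi, snd_scal_l. nra. }
destruct (line_log (p + w2) w1 a (-1)) as [T [cT [eT [jT kT]]]]; auto.
{ replace (RtoC (-1) * Ci / w1 * (p + w2 - a)) with
    (RtoC (-1) * Ci * (RtoC (- s0) + RtoC (1 - t0) * (w2 / w1)))
    by (unfold a, pt; rewrite RtoC_opp, RtoC_minus; field; auto).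
  rewrite fstCi, snd_scal_l. nra. }
destruct (line_log (p + w1) w2 a 1) as [R [cR [eR [jR kR]]]]; auto.
{ replace (RtoC 1 * Ci / w2 * (p + w1 - a)) with
    (RtoC 1 * Ci * (RtoC (- t0) + RtoC (1 - s0) * (w1 / w2)))
    by (unfold a, pt; rewrite RtoC_opp, RtoC_minus; field; auto).
  rewrite fstCi, snd_scal_l. nra. }
destruct (line_log p w2 a (-1)) as [L [cL [eL [jL kL]]]]; auto.
{ replace (RtoC (-1) * Ci / w2 * (p - a)) with
    (RtoC (-1) * Ci * (RtoC (- t0) + RtoC (- s0) * (w1 / w2)))
    by (unfold a, pt; rewrite !RtoC_opp; field; auto).
  rewrite fstCi, snd_scal_l. nra. }
assert (e0 : (0 <= 0 <= 1)%R) by lra. assert (e1 : (0 <= 1 <= 1)%R) by lra.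
destruct (cexp_eq (L 0%R) (B 0%R)) as [m1 h1]; [rewrite eL, eB; auto; ring|].
destruct (cexp_eq (B 1%R) (R 0%R)) as [m2 h2]; [rewrite eR, eB; auto; ring|].
destruct (cexp_eq (R 1%R) (T 1%R)) as [m3 h3]; [rewrite eR, eT; auto; ring|].
destruct (cexp_eq (T 0%R) (L 1%R)) as [m4 h4]; [rewrite eL, eT; auto; ring|].
assert (tot : (B 1%R - B 0%R) - (T 1%R - T 0%R) + ((R 1%R - R 0%R) - (L 1%R - L 0%R))
      = RtoC (IZR (m1 + m2 + m3 + m4)) * two_pi_i).
{ rewrite !plus_IZR, !RtoC_plus, h1, h2, h3, h4. ring. }
(* The total turn is a multiple of 2 pi strictly between 0 and 4 pi, hence a single full turn. *)
assert (M : (m1 + m2 + m3 + m4 = 1)%Z).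
{ apply (f_equal snd) in tot. simpl in tot.
  replace (IZR (m1 + m2 + m3 + m4) * (2 * PI) + 0 * 0)%R with
    (IZR (m1 + m2 + m3 + m4) * (2 * PI))%R in tot by ring.
  assert (pp := PI_RGT_0).
  assert (l1 : (0 < IZR (m1 + m2 + m3 + m4))%R) by nra.
  assert (l2 : (IZR (m1 + m2 + m3 + m4) < 2)%R) by nra.
  apply lt_IZR in l1. apply lt_IZR in l2. lia. }
(* Each corner enters with weight its jump: [m2] at [p + w1], [m3] at [p + w1 + w2], [m4] at
   [p + w2]. The four jumps sum to 1, which leaves [p] with coefficient 1. *)
exists (RtoC (IZR (m2 + m3)) * w1 + RtoC (IZR (m3 + m4)) * w2).
split; [now exists (m2 + m3)%Z, (m3 + m4)%Z|].
exists B, T, L, R. split; [auto|split; [|split]].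
- intros s hs. rewrite eB, eT, eL, eR by auto. unfold pt. repeat split; ring.
- rewrite tot, M. reflexivity.
- replace (w1 * (CInt B 0 1 - CInt T 0 1) + w2 * (CInt R 0 1 - CInt L 0 1)) with
    (w1 * CInt B 0 1 - w1 * CInt T 0 1 + (w2 * CInt R 0 1 - w2 * CInt L 0 1)) by ring.
  rewrite jB, jT, jR, jL, h1, h2, h3, h4, !plus_IZR, !RtoC_plus.
  assert (M' : RtoC (IZR m1) + RtoC (IZR m2) + RtoC (IZR m3) + RtoC (IZR m4) = 1).
  { rewrite <- !RtoC_plus, <- !plus_IZR, M. reflexivity. }
  replace (RtoC (IZR m1)) with (1 - RtoC (IZR m2) - RtoC (IZR m3) - RtoC (IZR m4))
    by (rewrite <- M'; ring).
  ring.
Qed.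

(** * Periodicity and factorisation *)

Lemma int_between (m n : Z) : IZR m = (IZR n + 1 / 2)%R -> False.
Proof.
intros h. assert (e : IZR (2 * m) = IZR (2 * n + 1)).
{ rewrite plus_IZR, !mult_IZR. lra. }
apply eq_IZR in e. lia.
Qed.

(** If the integer changed, the intermediate value theorem would produce a half-integer multiple of
    2 pi. *)
Lemma continuous_two_pi_i_multiple (D : R -> C) :
  ccont_on D 0 1 ->
  (forall s, (0 <= s <= 1)%R -> exists m : Z, D s = RtoC (IZR m) * two_pi_i) ->
  exists m : Z, forall s, (0 <= s <= 1)%R -> D s = RtoC (IZR m) * two_pi_i.
Proof.
intros hc hm. destruct (hm 0%R ltac:(lra)) as [m0 e0]. exists m0.
assert (im : forall m : Z, snd (RtoC (IZR m) * two_pi_i)%C = (IZR m * (2 * PI))%R).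
{ intro m. simpl. ring. }
assert (pp := PI_RGT_0).
intros s hs. destruct (hm s hs) as [m1 e1]. rewrite e1. do 3 f_equal.
destruct (Req_dec s 0) as [z|n].
{ rewrite z, e0 in e1. apply (f_equal snd) in e1. rewrite !im in e1. apply eq_IZR. nra. }
apply NNPP. intros hne.
assert (cs : forall c x, (0 <= x <= s)%R -> continuity_pt (fun x => snd (D x) - c)%R x).
{ intros c x hx. apply continuity_pt_filterlim.
  apply (continuous_minus (U := R_UniformSpace) (V := R_NormedModule) (fun x => snd (D x)) (fun _ => c)).
  - apply (ccont_snd (U := R_UniformSpace)), hc; lra.
  - apply continuous_const. }
destruct (Z.lt_total m0 m1) as [h|[h|h]]; [| now elim hne |].
- destruct (IVT_interv (fun x => snd (D x) - (IZR m0 + 1 / 2) * (2 * PI))%R 0 s) as [x [hx fx]].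
  + intros x hx. now apply cs.
  + lra.
  + rewrite e0, im. nra.
  + rewrite e1, im. assert (h' : (m0 + 1 <= m1)%Z) by lia. apply IZR_le in h'.
    rewrite plus_IZR in h'. nra.
  + destruct (hm x ltac:(lra)) as [m2 e2]. rewrite e2, im in fx.
    apply (int_between m2 m0). nra.
(* Negated, because [IVT_interv] wants a negative value on the left and a positive one on the
   right. *)
- destruct (IVT_interv (fun x => - (snd (D x) - (IZR m1 + 1 / 2) * (2 * PI)))%R 0 s) as [x [hx fx]].
  + intros x hx. apply continuity_pt_opp. now apply cs.
  + lra.
  + rewrite e0, im. assert (h' : (m1 + 1 <= m0)%Z) by lia. apply IZR_le in h'.
    rewrite plus_IZR in h'. nra.
  + rewrite e1, im. nra.
  + destruct (hm x ltac:(lra)) as [m2 e2]. rewrite e2, im in fx.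
    apply (int_between m2 m1). nra.
Qed.

Lemma log_difference (B T : R -> C) :
  ccont_on B 0 1 -> ccont_on T 0 1 ->
  (forall s, (0 <= s <= 1)%R -> cexp (B s) = cexp (T s)) ->
  exists m : Z, B 1%R - B 0%R - (T 1%R - T 0%R) = 0 /\
    CInt B 0 1 - CInt T 0 1 = RtoC (IZR m) * two_pi_i.
Proof.
intros cB cT h.
assert (cT' : ccont_on (fun s => RtoC (-1) * T s) 0 1).
{ intros s hs. apply ccont_mult; [apply ccont_const | auto]. }
destruct (continuous_two_pi_i_multiple (fun s => B s + RtoC (-1) * T s)) as [m hm].
- intros s hs. apply ccont_plus; auto.
- intros s hs. destruct (cexp_eq (B s) (T s) (h s hs)) as [k hk]. exists k. rewrite hk. ring.
- exists m. split.
  + replace (B 1%R - B 0%R - (T 1%R - T 0%R)) with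
      ((B 1%R + RtoC (-1) * T 1%R) - (B 0%R + RtoC (-1) * T 0%R)) by ring.
    rewrite !hm by lra. ring.
  + replace (CInt B 0 1 - CInt T 0 1) with (CInt B 0 1 + RtoC (-1) * CInt T 0 1) by ring.
    rewrite <- CInt_scal, <- CInt_plus by (auto; lra).
    rewrite (CInt_ext _ (fun _ => RtoC (IZR m) * two_pi_i)) by (auto; lra).
    rewrite CInt_const, Rminus_0_r. apply Cmult_1_l.
Qed.

Lemma log_moments_periodic (p w1 w2 : C) (F : C -> C) (k j : C) :
  (forall z, F (z + w1) = F z) -> (forall z, F (z + w2) = F z) ->
  log_moments p w1 w2 F k j -> k = 0 /\ lattice w1 w2 j.
Proof.
intros P1 P2 [B [T [L [R [[cB [cT [cL cR]]] [h [hk hj]]]]]]].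
assert (n2 := two_pi_i_ne0).
destruct (log_difference B T cB cT) as [m [e1 e2]].
{ intros s hs. destruct (h s hs) as [h1 [h2 _]]. rewrite h1, h2, <- (P2 (pt p w1 w2 s 0)).
  f_equal. unfold pt. ring. }
destruct (log_difference R L cR cL) as [n [f1 f2]].
{ intros s hs. destruct (h s hs) as [_ [_ [h3 h4]]]. rewrite h3, h4, <- (P1 (pt p w1 w2 0 s)).
  f_equal. unfold pt. ring. }
split.
- rewrite e1, f1 in hk.
  replace k with (k * two_pi_i * / two_pi_i) by (field; auto). rewrite <- hk. ring.
- exists m, n. rewrite e2, f2 in hj.
  replace j with (j * two_pi_i * / two_pi_i) by (field; auto). rewrite <- hj. field; auto.
Qed.

Lemma zpow_ne0 (z : C) (m : Z) : z <> 0 -> zpow z m <> 0.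
Proof.
intro n. unfold zpow. assert (q := Cpow_nz z (Z.to_nat (- m)) n).
apply Cmult_neq_0; [now apply Cpow_nz|].
intro e. apply C1_nz. rewrite <- (Cinv_l _ q), e. ring.
Qed.

Lemma chol_zpow (a z : C) (m : Z) : z <> a -> chol (fun y => zpow (y - a) m) z.
Proof.
intro n. unfold zpow.
assert (c : chol (fun y => y - a) z) by (apply chol_minus; [apply chol_id | apply chol_const]).
apply chol_mult; [now apply chol_pow|].
apply chol_inv; [now apply chol_pow | apply Cpow_nz; now apply Cminus_eq_contra].
Qed.

Lemma locally_neq (z a : C) : z <> a -> locally (T := C_UniformSpace) z (fun y => y <> a).
Proof.
intro n.
generalize (ccont_ne0 (U := C_UniformSpace) (fun y => y - a) z
  (ccont_minus _ _ _ (ccont_id z) (ccont_const a z)) (Cminus_eq_contra _ _ n)).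
apply filter_imp. intros y hy e. apply hy. rewrite e. ring.
Qed.

Fixpoint divisor_product (a : nat -> C) (m : nat -> Z) (n : nat) (z : C) : C :=
  match n with
  | O => 1
  | S k => divisor_product a m k z * zpow (z - a (S k)) (m (S k))
  end.

(** Induction on the number of points, dividing out the last factor; [F] is quantified after [n]
    because the induction hypothesis is applied to the quotient. The product formula is claimed only
    off the points, where [F] and [zpow] carry no default values. *)
Lemma divisor_factorisation (a : nat -> C) (m : nat -> Z) (Q : C -> Prop) (n : nat) :
  forall F : C -> C,
  (forall i j, (1 <= i <= n)%nat -> (1 <= j <= n)%nat -> a i = a j -> i = j) ->
  (forall z, Q z -> (forall k, (1 <= k <= n)%nat -> a k <> z) -> chol F z /\ F z <> 0) ->
  (forall k, (1 <= k <= n)%nat -> exists g, chol g (a k) /\ g (a k) <> 0 /\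
     locally' (T := C_UniformSpace) (a k) (fun y => F y = zpow (y - a k) (m k) * g y)) ->
  exists h, forall z, Q z -> chol h z /\ h z <> 0 /\
    ((forall k, (1 <= k <= n)%nat -> a k <> z) -> F z = h z * divisor_product a m n z).
Proof.
induction n as [|n IH]; intros F inj reg sing.
- exists F. intros z hz. destruct (reg z hz) as [h1 h2]; [intros; lia|].
  repeat split; auto. intros _. simpl. ring.
- unfold locally', within in sing.
  destruct (sing (S n)) as [g [g1 [g2 g3]]]; [lia|].
  set (b := a (S n)) in *. set (mu := m (S n)) in *.
  (* The singularity at [b] is removed by hand: the local factor [g] supplies the value there, so no
     removable singularity theorem is called for. *)
  set (F1 := fun y => if Ceq_dec y b then g y else F y * / zpow (y - b) mu).
  assert (F1b : forall y, y <> b -> F1 y = F y * / zpow (y - b) mu).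
  { intros y hy. unfold F1. destruct (Ceq_dec y b); congruence. }
  assert (nz : forall y, y <> b -> zpow (y - b) mu <> 0).
  { intros y hy. now apply zpow_ne0, Cminus_eq_contra. }
  destruct (IH F1) as [h hh].
  + intros i j hi hj. apply inj; lia.
  + intros z hz hk. destruct (Ceq_dec z b) as [e|ne].
    * assert (loc : locally (T := C_UniformSpace) z (fun y => g y = F1 y)).
      { rewrite e. generalize g3. apply filter_imp. intros y hy. change C in y.
        unfold F1. destruct (Ceq_dec y b) as [e'|ne']; auto.
        rewrite (hy ne'). field. now apply nz. }
      split.
      -- apply (chol_ext_loc g F1); auto. now rewrite e.
      -- rewrite <- (locally_singleton (T := C_UniformSpace) _ _ loc). now rewrite e.
    * destruct (reg z hz) as [r1 r2].
      { intros k hk'. destruct (Nat.eq_dec k (S n)) as [e'|ne'].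
        - subst k. fold b. congruence.
        - apply hk; lia. }
      split.
      -- apply (chol_ext_loc (fun y => F y * / zpow (y - b) mu)).
         ++ generalize (locally_neq z b ne). apply filter_imp. intros y hy.
            symmetry. now apply F1b.
         ++ apply chol_mult; auto. apply chol_inv; [now apply chol_zpow | now apply nz].
      -- rewrite F1b by auto. apply Cmult_neq_0; auto.
         intro e'. apply C1_nz. rewrite <- (Cinv_l _ (nz z ne)), e'. ring.
  + unfold locally', within. intros k hk. destruct (sing k) as [u [u1 [u2 u3]]]; [lia|].
    assert (ne : a k <> b).
    { intro e. assert (k = S n) by (apply inj; auto; lia). lia. }
    exists (fun y => u y * / zpow (y - b) mu). split; [|split].
    * apply chol_mult; auto. apply chol_inv; [now apply chol_zpow | now apply nz].
    * apply Cmult_neq_0; auto.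
      intro e'. apply C1_nz. rewrite <- (Cinv_l _ (nz _ ne)), e'. ring.
    * generalize (filter_and _ _ (locally_neq (a k) b ne) u3). apply filter_imp.
      intros y [y1 y2] y3. change C in y. rewrite F1b, y2 by auto. ring.
  + exists h. intros z hz. destruct (hh z hz) as [h1 [h2 h3]]. repeat split; auto.
    intros hk. simpl. fold b mu.
    assert (ne : z <> b) by (intro e; apply (hk (S n)); [lia | now symmetry]).
    rewrite Cmult_assoc, <- h3 by (intros; apply hk; lia).
    rewrite F1b by auto. field. now apply nz.
Qed.

Lemma lattice_plus (w1 w2 u v : C) :
  lattice w1 w2 u -> lattice w1 w2 v -> lattice w1 w2 (u + v).
Proof.
intros [a [b ->]] [c [d ->]]. exists (a + c)%Z, (b + d)%Z.
rewrite !plus_IZR, !RtoC_plus. ring.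
Qed.

Lemma lattice_Zmult (w1 w2 u : C) (m : Z) :
  lattice w1 w2 u -> lattice w1 w2 (RtoC (IZR m) * u).
Proof.
intros [a [b ->]]. exists (m * a)%Z, (m * b)%Z.
rewrite !mult_IZR, !RtoC_mult. ring.
Qed.

Lemma sum_1_S (u : nat -> C) (n : nat) :
  sum_n_m u 1 (S n) = sum_n_m u 1 n + u (S n).
Proof. rewrite sum_n_Sm by lia. reflexivity. Qed.

(** The first moment [k] need not be computed: periodicity will force it to be 0, which also
    eliminates the translation [p]. *)
Lemma log_moments_divisor_product (p w1 w2 : C) (a : nat -> C) (m : nat -> Z) (n : nat) :
  w1 <> 0 -> w2 <> 0 -> (0 < snd (w2 / w1)%C)%R ->
  (forall k, (1 <= k <= n)%nat ->
    exists s t, (0 < s < 1)%R /\ (0 < t < 1)%R /\ a k = pt p w1 w2 s t) ->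
  exists lam k, lattice w1 w2 lam /\
    log_moments p w1 w2 (divisor_product a m n) k
      (p * k - sum_n_m (fun i => a i * RtoC (IZR (m i))) 1 n + lam).
Proof.
intros n1 n2 hw. induction n as [|n IH]; intros ha.
- exists 0, 0. split; [exists 0%Z, 0%Z; ring|].
  rewrite sum_n_m_zero by lia. change (@zero C_AbelianMonoid) with (RtoC 0).
  replace (p * 0 - 0 + 0) with (RtoC 0) by ring.
  apply log_moments_nonvanishing; intros; [apply chol_const | apply C1_nz].
- destruct IH as [lam [k [h1 h2]]]; [intros; apply ha; lia|].
  destruct (ha (S n)) as [s [t [hs [ht e]]]]; [lia|].
  destruct (log_moments_linear p w1 w2 s t n1 n2 hw hs ht) as [mu [k1 k2]].
  rewrite <- e in k2.
  exists (lam + RtoC (IZR (m (S n))) * mu), (k + RtoC (IZR (m (S n))) * 1).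
  split; [apply lattice_plus; auto; now apply lattice_Zmult|].
  rewrite sum_1_S.
  match goal with |- log_moments _ _ _ _ _ ?v => replace v with
    ((p * k - sum_n_m (fun i => a i * RtoC (IZR (m i))) 1 n + lam) +
      RtoC (IZR (m (S n))) * (p - a (S n) + mu)) by ring end.
  apply (log_moments_mult p w1 w2 (divisor_product a m n)
    (fun z => zpow (z - a (S n)) (m (S n)))); auto.
  now apply (log_moments_zpow p w1 w2 (fun z => z - a (S n))).
Qed.

(** * Elliptic functions *)

(** The default 0 at infinity preserves periodicity, and the factorisation sees a pole only through
    punctured neighbourhoods. *)
Definition fvalue (f : C -> sphere) (z : C) : C :=
  match f z with Some w => w | None => 0 end.

Lemma fvalue_some (f : C -> sphere) (z w : C) : f z = Some w -> fvalue f z = w.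
Proof. unfold fvalue. now intros ->. Qed.

Lemma holomorphic_at_chol (g : C -> C) (z : C) : holomorphic_at g z -> chol g z.
Proof. intro h. apply ex_derive_chol. exact (locally_singleton _ _ h). Qed.

Lemma regular_nonzero (f : C -> sphere) (z : C) :
  meromorphic f -> ~ is_zero f z -> ~ is_pole f z ->
  chol (fvalue f) z /\ fvalue f z <> 0.
Proof.
intros hm hz hp. destruct (hm z) as [[g [g1 g2]]|h]; [|contradiction].
split.
- apply (chol_ext_loc g); [|now apply holomorphic_at_chol].
  generalize g2. apply filter_imp. intros y hy. symmetry. now apply fvalue_some.
- assert (e := locally_singleton (T := C_UniformSpace) _ _ g2). simpl in e.
  rewrite (fvalue_some _ _ _ e). intro e0. apply hz. unfold is_zero. now rewrite e, e0.
Qed.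

Lemma multiplicity_factor (f : C -> sphere) (a : C) (k : Z) :
  has_multiplicity f a k -> exists g, chol g a /\ g a <> 0 /\
    locally' (T := C_UniformSpace) a (fun y => fvalue f y = zpow (y - a) k * g y).
Proof.
intros [m [[[_ [g [g1 [g2 g3]]]] ->] | [[_ [_ [g [g1 [g2 g3]]]]] ->]]];
  exists g; (split; [now apply holomorphic_at_chol|]); split; auto; unfold zpow.
- rewrite Nat2Z.id. replace (Z.to_nat (- Z.of_nat m)) with O by lia.
  unfold locally', within. generalize g3. apply filter_imp. intros y hy _. change C in y.
  rewrite (fvalue_some _ _ _ hy). simpl. field.
- rewrite Z.opp_involutive, Nat2Z.id. replace (Z.to_nat (- Z.of_nat m)) with O by lia.
  generalize g3. apply filter_imp. intros y hy. change C in y.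
  rewrite (fvalue_some _ _ _ hy). simpl. unfold Cdiv. ring.
Qed.

(** The value alone decides: at infinity [f] cannot be regular, so meromorphy makes the point a
    pole, and no local expansion has to be translated. *)
Lemma is_pole_translate (f : C -> sphere) (z z' : C) :
  meromorphic f -> f z' = f z -> is_pole f z -> is_pole f z'.
Proof.
intros hm e [m [_ [hn _]]]. destruct (hm z') as [[g [_ g2]]|h]; auto.
assert (e' := locally_singleton (T := C_UniformSpace) _ _ g2). simpl in e'. congruence.
Qed.

Lemma coordinates_unique (w1 w2 : C) (s t s' t' : R) :
  w1 <> 0 -> (0 < snd (w2 / w1)%C)%R ->
  RtoC s * w1 + RtoC t * w2 = RtoC s' * w1 + RtoC t' * w2 -> s = s' /\ t = t'.
Proof.
intros n1 hw e.
assert (e' : RtoC s + RtoC t * (w2 / w1) = RtoC s' + RtoC t' * (w2 / w1)).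
{ replace (RtoC s + RtoC t * (w2 / w1)) with ((RtoC s * w1 + RtoC t * w2) / w1) by (field; auto).
  rewrite e. field; auto. }
set (u := w2 / w1) in *. destruct u as [x y].
assert (h1 := f_equal fst e'). assert (h2 := f_equal snd e'). simpl in h1, h2, hw.
assert (t = t') by nra. split; nra.
Qed.

(** Finitely many coordinates below 1 leave a common gap. Shifting the parallelogram back by part of
    that gap moves the points off its lower sides without losing any through the upper ones. *)
Lemma common_margin (w1 w2 : C) (a : nat -> C) (n : nat) :
  (forall k, (1 <= k <= n)%nat -> parallelogram w1 w2 (a k)) ->
  exists sigma, (0 < sigma < 1)%R /\ forall k, (1 <= k <= n)%nat ->
    exists s t, (0 <= s < 1 - sigma)%R /\ (0 <= t < 1 - sigma)%R /\
      a k = RtoC s * w1 + RtoC t * w2.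
Proof.
induction n as [|n IH]; intros h.
- exists (1 / 2)%R. split; [lra|]. intros; lia.
- destruct IH as [x [hx hk]]; [intros; apply h; lia|].
  destruct (h (S n)) as [s [t [hs [ht e]]]]; [lia|].
  (* Halving makes the inequalities [s < 1 - y] and [t < 1 - y] strict. *)
  set (y := Rmin x (Rmin ((1 - s) / 2) ((1 - t) / 2))).
  assert (y1 : (y <= x)%R) by apply Rmin_l.
  assert (y2 : (y <= (1 - s) / 2)%R) by (eapply Rle_trans; [apply Rmin_r | apply Rmin_l]).
  assert (y3 : (y <= (1 - t) / 2)%R) by (eapply Rle_trans; [apply Rmin_r | apply Rmin_r]).
  assert (y0 : (0 < y)%R) by (repeat apply Rmin_pos; lra).
  exists y. split; [lra|]. intros k hk'. destruct (Nat.eq_dec k (S n)) as [->|ne].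
  + exists s, t. repeat split; auto; lra.
  + destruct (hk k) as [s' [t' [h1 [h2 h3]]]]; [lia|]. exists s', t'. repeat split; auto; lra.
Qed.

(** A coordinate moved up by 1 was negative but at least [- sigma], so it lands in the margin
    [[1 - sigma, 1)], where no zero or pole has a coordinate. *)
Lemma unit_shift (x sigma : R) : (0 < sigma < 1)%R -> (0 <= x <= 1)%R ->
  exists b : Z, (0 <= x - sigma + IZR b < 1)%R /\ (x - sigma + IZR b < 1 - sigma -> b = 0%Z)%R.
Proof.
intros h1 h2. destruct (Rle_dec 0 (x - sigma)).
- exists 0%Z. split; [simpl; lra | auto].
- exists 1%Z. split; [simpl; lra | simpl; lra].
Qed.

Lemma period_shift (f : C -> sphere) (w : C) (b : Z) :
  (forall z, f (z + w) = f z) -> (b = 0 \/ b = 1)%Z ->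
  forall z, f (z + RtoC (IZR b) * w) = f z.
Proof.
intros h [-> | ->] z; [f_equal; ring|]. rewrite Cmult_1_l. apply h.
Qed.

Lemma proposition6_oriented (w1 w2 : C) (f : C -> sphere)
    (n : nat) (a : nat -> C) (m : nat -> Z) :
  w1 <> 0 -> w2 <> 0 -> (0 < snd (w2 / w1)%C)%R -> elliptic w1 w2 f ->
  (forall i j, (1 <= i <= n)%nat -> (1 <= j <= n)%nat -> a i = a j -> i = j) ->
  (forall z : C, (parallelogram w1 w2 z /\ (is_zero f z \/ is_pole f z)) <->
    (exists k : nat, (1 <= k <= n)%nat /\ a k = z)) ->
  (forall k : nat, (1 <= k <= n)%nat -> has_multiplicity f (a k) (m k)) ->
  lattice w1 w2 (sum_n_m (fun k : nat => a k * RtoC (IZR (m k))) 1 n).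
Proof.
intros n1 n2 hw [hm hper] inj ha mult.
assert (P1 := fun z => proj1 (hper z)). assert (P2 := fun z => proj2 (hper z)).
simpl in P1, P2.
destruct (common_margin w1 w2 a n) as [sg [hsg coord]].
{ intros k hk. apply (proj2 (ha (a k))). eauto. }
set (p := - (RtoC sg * w1) - RtoC sg * w2).
assert (pt_p : forall s t, pt p w1 w2 s t = RtoC (s - sg) * w1 + RtoC (t - sg) * w2).
{ intros s t. unfold pt, p. rewrite !RtoC_minus. ring. }
assert (inner : forall k, (1 <= k <= n)%nat ->
    exists s t, (0 < s < 1)%R /\ (0 < t < 1)%R /\ a k = pt p w1 w2 s t).
{ intros k hk. destruct (coord k hk) as [s [t [hs [ht e]]]].
  exists (s + sg)%R, (t + sg)%R. repeat split; try lra.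
  rewrite pt_p, e. do 2 f_equal; do 2 f_equal; ring. }
assert (bdry : forall k s t, (1 <= k <= n)%nat -> (s = 0 \/ s = 1 \/ t = 0 \/ t = 1)%R ->
  a k <> pt p w1 w2 s t).
{ intros k s t hk hst e. destruct (inner k hk) as [s' [t' [hs [ht e']]]].
  rewrite e', !pt_p in e. apply coordinates_unique in e; auto. lra. }
set (Q := fun z => exists s t, (0 <= s <= 1)%R /\ (0 <= t <= 1)%R /\ z = pt p w1 w2 s t).
assert (only : forall z, Q z -> (is_zero f z \/ is_pole f z) ->
  exists k, (1 <= k <= n)%nat /\ a k = z).
(* Translated by periods into the fundamental parallelogram, [z] becomes some [a k]. Since [a k]
   avoids the margin, the translation was trivial and [z] is [a k]; so even the closed shifted
   parallelogram contains no further zero or pole. *)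
{ intros z [s [t [hs [ht e]]]] hz.
  destruct (unit_shift s sg hsg hs) as [b [hb hb0]].
  destruct (unit_shift t sg hsg ht) as [c [hc hc0]].
  set (z' := z + RtoC (IZR b) * w1 + RtoC (IZR c) * w2).
  assert (ef : f z' = f z).
  { unfold z'. rewrite (period_shift f w2 c P2), (period_shift f w1 b P1); auto.
    all: assert (q1 : (IZR (-1) < IZR b)%R) by (simpl; lra);
      assert (q2 : (IZR b < IZR 2)%R) by (simpl; lra);
      assert (q3 : (IZR (-1) < IZR c)%R) by (simpl; lra);
      assert (q4 : (IZR c < IZR 2)%R) by (simpl; lra);
      apply lt_IZR in q1, q2, q3, q4; lia. }
  assert (ez : z' = RtoC (s - sg + IZR b) * w1 + RtoC (t - sg + IZR c) * w2).
  { unfold z'. rewrite e, pt_p, (RtoC_plus (s - sg)), (RtoC_plus (t - sg)). ring. }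
  destruct (proj1 (ha z')) as [k [hk ek]].
  - split; [now exists (s - sg + IZR b)%R, (t - sg + IZR c)%R|].
    destruct hz as [hz|hz]; [left; unfold is_zero in *; congruence|].
    right. now apply (is_pole_translate f z).
  - exists k. split; auto. destruct (coord k hk) as [s' [t' [hs' [ht' e']]]].
    assert (u := e'). rewrite ek, ez in u. apply coordinates_unique in u; auto.
    destruct u as [u1 u2].
    rewrite ek. unfold z'. rewrite hb0, hc0 by lra. ring. }
destruct (divisor_factorisation a m Q n (fvalue f) inj) as [h hh].
{ intros z hz hk. apply regular_nonzero; auto.
  - intro e. destruct (only z hz (or_introl e)) as [k [k1 k2]]. now apply (hk k).
  - intro e. destruct (only z hz (or_intror e)) as [k [k1 k2]]. now apply (hk k). }
{ intros k hk. now apply multiplicity_factor, mult. }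
assert (inQ : forall s t, (0 <= s <= 1)%R -> (0 <= t <= 1)%R -> Q (pt p w1 w2 s t)).
{ intros s t hs ht. now exists s, t. }
destruct (log_moments_divisor_product p w1 w2 a m n n1 n2 hw inner) as [lam [k [hlam hk]]].
assert (M := log_moments_mult _ _ _ _ _ _ _ _ _
  (log_moments_nonvanishing p w1 w2 h
    (fun s t hs ht => proj1 (hh _ (inQ s t hs ht)))
    (fun s t hs ht => proj1 (proj2 (hh _ (inQ s t hs ht))))) hk).
apply (log_moments_ext _ _ _ _ (fvalue f)) in M.
2:{ intros s hs. repeat split; symmetry; apply hh; try (apply inQ; lra);
      intros i hi; apply bdry; auto. }
apply log_moments_periodic in M.
2:{ intro z. unfold fvalue. now rewrite P1. }
2:{ intro z. unfold fvalue. now rewrite P2. }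
destruct M as [k0 hl]. rewrite Cplus_0_l in k0. rewrite k0 in hl.
apply (lattice_Zmult _ _ _ (-1)) in hl.
(* With [k = 0], the second moment is [lam] minus the sum, so the sum is the difference of two
   lattice elements. *)
match goal with |- lattice _ _ ?v => replace v with
  (lam + RtoC (-1) * (0 + (p * 0 - v + lam))) by ring end.
now apply lattice_plus.
Qed.

Lemma lattice_swap (w1 w2 z : C) : lattice w2 w1 z -> lattice w1 w2 z.
Proof. intros [a [b ->]]. exists b, a. ring. Qed.

Lemma parallelogram_swap (w1 w2 z : C) : parallelogram w2 w1 z <-> parallelogram w1 w2 z.
Proof.
split; intros [s [t [hs [ht ->]]]]; exists t, s; (split; [auto | split; [auto | ring]]).
Qed.

Theorem proposition6 (w1 w2 : C) (f : C -> sphere)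
    (n : nat) (a : nat -> C) (m : nat -> Z)
    (hw1 : w1 <> 0) (hw2 : w2 <> 0)
    (hw : forall r : R, w1 / w2 <> RtoC r)
    (hf : elliptic w1 w2 f)
    (hf0 : exists z : C, f z <> Some (RtoC 0))
    (* a 1, ..., a n are the distinct zeros and poles of f in the parallelogram *)
    (ha_inj : forall i j : nat,
        (1 <= i <= n)%nat -> (1 <= j <= n)%nat -> a i = a j -> i = j)
    (ha : forall z : C,
        (parallelogram w1 w2 z /\ (is_zero f z \/ is_pole f z)) <->
        (exists k : nat, (1 <= k <= n)%nat /\ a k = z))
    (hm : forall k : nat, (1 <= k <= n)%nat -> has_multiplicity f (a k) (m k)) :
  lattice w1 w2 (sum_n_m (fun k : nat => a k * RtoC (IZR (m k))) 1 n).
Proof.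
(* A nonreal ratio has an imaginary part of one sign or the other. Exchanging the periods reverses
   it and changes neither the lattice nor the parallelogram, so a positive orientation can be
   assumed. *)
assert (hs : snd (w1 / w2)%C <> 0%R).
{ intro e. apply (hw (fst (w1 / w2)%C)). now apply Ceq_components. }
destruct (Rtotal_order 0 (snd (w1 / w2)%C)) as [h|[h|h]].
- apply lattice_swap.
  apply (proposition6_oriented w2 w1 f n a m); auto.
  + destruct hf as [h1 h2]. split; auto. intro z. split; apply h2.
  + intro z. rewrite parallelogram_swap. apply ha.
- now elim hs.
- apply (proposition6_oriented w1 w2 f n a m); auto.
  replace (w2 / w1) with (/ (w1 / w2)) by (field; auto).
  now apply snd_inv_pos.
Qed.
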